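(* Let $T>0$. Let $h\colon\mathbb{R}^{+}\to\mathbb{R}$ be continuous and bounded. Let $g\colon\mathbb{R}^{+}\to\mathbb{R}^{+}$ be a continuous function, regularly oscillating at zero, with $g(0)=0$ and $g(s)>0$ for $s>0$. Assume \[ \lim_{s\to0^{+}}\frac{g(s)}{s}=0\quad\text{and}\quad\lim_{s\to+\infty}\frac{g(s)}{s}=+\infty. \] Let $a\colon[0,T]\to\mathbb{R}$ be a continuous function such that: (i) there exist $m\ge1$ closed and pairwise disjoint intervals $I_1,\dots,I_m\subseteq[0,T]$ for which, for $i=1,\dots,m$, $a(x)\ge0$ for a.e. $x\in I_i$ with $a\not\equiv0$ on $I_i$, and $a(x)\le0$ for a.e. $x\in[0,T]\setminus\bigcup_{i=1}^{m}I_i$; (ii) $\int_{0}^{T}a(x)\,dx<0$. Then the periodic problem \[ u''+h(u)u'+a(x)g(u)=0\ \text{ on }(0,T),\qquad u(0)=u(T),\quad u'(0)=u'(T), \] has at least one positive solution.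
   Context: $\mathbb{R}^{+}=[0,+\infty)$. A positive solution is a (classical, $\mathcal{C}^2$) solution $u$ on $[0,T]$ of the equation with the stated boundary conditions such that $u(x)>0$ for every $x\in[0,T]$. The function $g$ is regularly oscillating at zero if $\lim_{s\to0^{+},\,\omega\to1}\frac{g(\omega s)}{g(s)}=1$ (joint limit). ''$a\not\equiv0$ on $I_i$'' means that $a$ is not a.e. zero on $I_i$. *)

(* Defs.v *)
From mathcomp Require Export all_boot all_order all_algebra.
From mathcomp Require Export all_classical all_reals all_analysis.

Set Implicit Arguments.
Unset Strict Implicit.
Unset Printing Implicit Defensive.

Export Order.TTheory GRing.Theory Num.Theory.
Export numFieldNormedType.Exports.

Local Open Scope classical_set_scope.
Local Open Scope ring_scope.

(* Functions on [0, +oo[ or [0, T] are total functions on R that are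
   constrained only on that set. *)

(* The product filter gives the joint limit s -> 0+, w -> 1. *)
Definition regularly_oscillating_at_zero (R : realType) (g : R -> R) : Prop :=
  g (p.2 * p.1) / g p.1 @[p --> (0^'+, (1 : R)^')] --> (1 : R).

(* The difference quotient stays inside D: for D = [0, T] this is the
   one-sided derivative at 0 and at T. *)
Definition is_derive_within (R : realType) (D : set R) (f : R -> R)
    (x l : R) : Prop :=
  (f y - f x) / (y - x) @[y --> within D x^'] --> l.

Definition periodic_solution (R : realType) (T : R) (h a g u : R -> R) : Prop :=
  exists u' u'' : R -> R,
    [/\ forall x, x \in `[0, T] -> is_derive_within `[0, T] u x (u' x),
        forall x, x \in `[0, T] -> is_derive_within `[0, T] u' x (u'' x),
        {within `[0, T], continuous u''},
        forall x, x \in `]0, T[ ->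
          u'' x + h (u x) * u' x + a x * g (u x) = 0
      & u 0 = u T /\ u' 0 = u' T].

(* Main.v *)
Require Import Defs.
From mathcomp Require Import ring lra.

(** With [H' = h], the equation reads [u' = y - H u], [y' = - a g(u)]. Start the
period at a point [c] where [a > 0], truncate [H] and [g], and shoot. The planar
Poincaré-Miranda theorem, applied to Euler polygons followed by a compactness
argument, yields a solution with [u(T) = u(0)] and [y(T) - y(0) = - phi(max u)],
where [phi] is positive below a small [r], vanishes on [[r, Rs]] and is negative
above [Rs].

If [max u < r], then [u] is so close to its maximum that, by regular oscillation,
[g(u)] is almost constant, and [y(T) - y(0) = - int a g(u)] has the sign of
[- int a > 0]: impossible. If [max u > Rs], the jump of [y] at [c] is of the sign
preserved by the maximum principle, so [u > 0], and [u] attains its maximum on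
some [I_i], where it is concave up to an integrating factor; there superlinear
growth of [g] forces [u'] to vary more than concavity allows. Hence the jump is
zero and [u] is periodic. *)

Set Implicit Arguments.
Unset Strict Implicit.
Unset Printing Implicit Defensive.

Local Open Scope classical_set_scope.
Local Open Scope ring_scope.

(** * Planar Poincaré-Miranda theorem *)

(** The field is only continuous, because [g] is, so the flow need not be single valued; an Euler
    polygon is a continuous function of its start [(u(0), y(0))], and its errors in the boundary
    conditions vanish in the limit. In the variable [y] the variation over a period is at most
    [C = A Gm T], whatever [u] does. Hence a large [|y(0)|] fixes the sign of [u(T) - u(0)], and a
    large [|u(0)|] makes [phi] dominate: these are the four sign conditions on a rectangle.

    The correction [phi (max u)] sits in the boundary condition and not in the equation, so inside
    the period the true equation holds as soon as the truncation is inactive. Its price is a jump of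
    [y] at the base point. Propagating a maximum to the right uses the velocity from the left, which
    is lost just after the jump. A base point interior to some [I_i], with [a > 0] around it, sends
    a maximum at either end of the period to the concavity argument, which needs one side only. The
    rotated weight then jumps where the original period ends, since [a 0] and [a T] may differ. *)

Section Parity.

Variables (f g : nat -> nat -> bool) (n : nat).

(** The doors of a Sperner-type count; [row_parity] counts them modulo 2 along a row. *)
Let edge i j i' j' := [&& ~~ f i j, ~~ f i' j' & g i j (+) g i' j'].

Fixpoint row_parity (j k : nat) : bool :=
  if k is k'.+1 then edge k' j k'.+1 j (+) row_parity j k' else false.

Let mixed (P : nat -> nat -> bool) i j :=
  [|| P i j, P i.+1 j, P i j.+1 | P i.+1 j.+1] &&
  ~~ [&& P i j, P i.+1 j, P i j.+1 & P i.+1 j.+1].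

(* The boundary of the grid has an odd number of edges joining
   [~~ f && ~~ g] to [~~ f && g], hence so does the boundary of some cell. *)
Lemma mixed_cell :
  (forall i, (i <= n)%N -> f i 0%N) -> (forall i, (i <= n)%N -> ~~ f i n) ->
  (forall j, (j <= n)%N -> ~~ g 0%N j) -> (forall j, (j <= n)%N -> g n j) ->
  exists i j, [/\ (i < n)%N, (j < n)%N, mixed f i j & mixed g i j].
Proof.
move=> f0 fn g0 gn; apply: contrapT => nomix.
(* If [f] or [g] is constant on the corners of a cell, the number of doors around the cell is even:
   a check of all truth values. *)
have cell i j : (i < n)%N -> (j < n)%N ->
    edge i j i.+1 j (+) edge i j.+1 i.+1 j.+1 =
    edge i j i j.+1 (+) edge i.+1 j i.+1 j.+1.
  move=> ni nj; have : ~~ (mixed f i j && mixed g i j).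
    by apply/negP => /andP[mf mg]; apply: nomix; exists i, j.
  rewrite /edge /mixed.
  by case: (f i j) (f i.+1 j) (f i j.+1) (f i.+1 j.+1)
    (g i j) (g i.+1 j) (g i j.+1) (g i.+1 j.+1)
    => [] [] [] [] [] [] [] [].
have strip j k : (j < n)%N -> (k <= n)%N ->
    row_parity j k (+) row_parity j.+1 k = edge 0 j 0 j.+1 (+) edge k j k j.+1.
  move=> nj; elim: k => [|k IH] nk /=; first by rewrite addbb.
  rewrite addbACA cell // IH ?(ltnW nk) //.
  by case: (edge 0 j 0 j.+1) (edge k j k j.+1) => [] [];
    case: (edge k.+1 j k.+1 j.+1).
(* After telescoping, the doors between two rows remain only in the outer columns, where [g] is
   constant. *)
have same j : (j < n)%N -> row_parity j n = row_parity j.+1 n.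
  move=> nj; have := strip _ _ nj (leqnn n).
  rewrite /edge (negbTE (g0 j _)) ?(negbTE (g0 j.+1 _)) ?gn ?(ltnW nj) //=.
  by rewrite !andbF /=; case: (row_parity j n) (row_parity j.+1 n) => [] [].
(* [f] holds on the bottom row, so it has no door; it fails on the top row, where the doors count
   the changes of [g], an odd number. *)
have bottom : row_parity 0 n = false.
  suff: forall k, (k <= n)%N -> row_parity 0 k = false by apply.
  by elim=> [|k IH] nk //=; rewrite /edge f0 ?(ltnW nk) //= IH ?(ltnW nk).
have top : row_parity n n = true.
  suff: forall k, (k <= n)%N -> row_parity n k = g k n.
    by move=> ->; rewrite // gn.
  elim=> [|k IH] nk /=; first by apply/esym/negbTE/g0.
  rewrite /edge fn ?(ltnW nk) // fn // IH ?(ltnW nk) //.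
  by case: (g k n) (g k.+1 n) => [] [].
suff : forall j, (j <= n)%N -> row_parity j n = false.
  by move=> /(_ n (leqnn n)); rewrite top.
by elim=> [|j IH] nj //; rewrite -same // IH // ltnW.
Qed.

End Parity.

Section PoincareMiranda.
Variable R : realType.

Definition unif_cont2 (F : R -> R -> R) := forall e : R, 0 < e -> exists2 d : R, 0 < d &
  forall c c' p p', `|c - c'| < d -> `|p - p'| < d -> `|F c p - F c' p'| < e.

Definition grid (n : nat) (D : R) (i : nat) := - D + D *+ 2 * (i%:R / n%:R).

Lemma grid_bound n D i : 0 < D -> (0 < n)%N -> (i <= n)%N -> `|grid n D i| <= D.
Proof.
move=> D0 n0 ni; rewrite /grid.
have t0 : 0 <= i%:R / n%:R :> R by rewrite divr_ge0.
have t1 : i%:R / n%:R <= 1 :> R by rewrite ler_pdivrMr ?ltr0n // mul1r ler_nat.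
move: (i%:R / n%:R) t0 t1 => t t0 t1.
have h0 : 0 <= D *+ 2 * t by rewrite mulr_ge0 // mulrn_wge0 // ltW.
have h1 : D *+ 2 * t <= D *+ 2 by rewrite ler_piMr // mulrn_wge0 // ltW.
by rewrite ler_norml; apply/andP; split; move: h0 h1; rewrite mulr2n; lra.
Qed.

Lemma grid_step n D B d i j : 0 < D -> D <= B -> 0 < d -> B *+ 2 / d < n%:R ->
  (i <= j <= i.+1)%N -> `|grid n D i - grid n D j| < d.
Proof.
move=> D0 DB d0 nB ij.
have n0 : 0 < n%:R :> R.
  by apply: le_lt_trans nB; rewrite divr_ge0 ?mulrn_wge0 ?(ltW d0) // (le_trans (ltW D0)).
have h : `|i%:R - j%:R| <= 1 :> R.
  case/andP: ij; rewrite leq_eqVlt => /orP[/eqP-> _|]; first by rewrite subrr normr0.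
  move=> ij ji; have -> : j = i.+1 by apply/eqP; rewrite eqn_leq ji.
  by rewrite -[i.+1]addn1 natrD opprD addrA subrr sub0r normrN normr1.
have -> : grid n D i - grid n D j = D *+ 2 * (i%:R - j%:R) / n%:R.
  by rewrite /grid; ring.
rewrite normrM normrM [`|n%:R^-1|]gtr0_norm ?invr_gt0 //.
rewrite ltr_pdivrMr // ger0_norm ?mulrn_wge0 ?(ltW D0) //.
apply: (@le_lt_trans _ _ (B *+ 2)); last by rewrite mulrC -ltr_pdivrMr.
rewrite -[leRHS]mulr1 ler_pM ?mulrn_wge0 ?(ltW D0) //.
by rewrite lerMn2r DB.
Qed.

(** In a mixed cell of a fine mesh each function takes both signs at corners where it differs by
    less than [e] from its value at the first corner. Approximate zeros are enough, since the limit
    is taken later on the polygons. *)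
Lemma poincare_miranda (F G : R -> R -> R) (N P : R) : 0 < N -> 0 < P ->
  unif_cont2 F -> unif_cont2 G ->
  (forall c, `|c| <= N -> F c (- P) < 0) ->
  (forall c, `|c| <= N -> 0 <= F c P) ->
  (forall p, `|p| <= P -> 0 <= G (- N) p) ->
  (forall p, `|p| <= P -> G N p < 0) ->
  forall e : R, 0 < e -> exists c p : R,
    [/\ `|c| <= N, `|p| <= P, `|F c p| < e & `|G c p| < e].
Proof.
move=> N0 P0 Fu Gu Fm FP Gm GP e e0.
have [dF dF0 {}Fu] := Fu _ e0; have [dG dG0 {}Gu] := Gu _ e0.
set d := Num.min dF dG; have d0 : 0 < d by rewrite lt_min dF0.
(* [B] bounds both half-lengths, so that one mesh number [n] serves both axes. *)
set B := Num.max N P.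
have NB : N <= B by rewrite le_max lexx.
have PB : P <= B by rewrite le_max lexx orbT.
have [n n0 nB] : exists2 n, (0 < n)%N & B *+ 2 / d < n%:R.
  by exists (Num.truncn (B *+ 2 / d)).+1 => //; exact: truncnS_gt.
have x0 D : grid n D 0 = - D by rewrite /grid mul0r mulr0 addr0.
have xn D : grid n D n = D.
  by rewrite /grid divff ?mulr1 ?mulr2n ?addKr // pnatr_eq0 -lt0n.
have xle (D : R) i : 0 < D -> (i <= n)%N -> `|grid n D i| <= D by move=> *; exact: grid_bound.
pose f i j := F (grid n N i) (grid n P j).
pose g i j := G (grid n N i) (grid n P j).
have [| | | |i [j [ni nj mf mg]]] := @mixed_cell
    (fun i j => f i j < 0) (fun i j => g i j < 0) n.
- by move=> i ni; rewrite /f x0 Fm // xle.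
- by move=> i ni; rewrite /f xn -leNgt FP // xle.
- by move=> i ni; rewrite /g x0 -leNgt Gm // xle.
- by move=> i ni; rewrite /g xn GP // xle.
have close i' j' : (i <= i' <= i.+1)%N -> (j <= j' <= j.+1)%N ->
    `|f i j - f i' j'| < e /\ `|g i j - g i' j'| < e.
  move=> ii jj; have hN := grid_step N0 NB d0 nB ii.
  have hP := grid_step P0 PB d0 nB jj.
  split; [apply: Fu|apply: Gu].
  - by apply: lt_le_trans hN _; rewrite ge_min lexx.
  - by apply: lt_le_trans hP _; rewrite ge_min lexx.
  - by apply: lt_le_trans hN _; rewrite ge_min lexx orbT.
  - by apply: lt_le_trans hP _; rewrite ge_min lexx orbT.
have small (h : nat -> nat -> R) :
    (forall i' j', (i <= i' <= i.+1)%N -> (j <= j' <= j.+1)%N -> `|h i j - h i' j'| < e) ->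
    [|| h i j < 0, h i.+1 j < 0, h i j.+1 < 0 | h i.+1 j.+1 < 0] &&
    ~~ [&& h i j < 0, h i.+1 j < 0, h i j.+1 < 0 & h i.+1 j.+1 < 0] -> `|h i j| < e.
  move=> {}close /andP[neg pos].
  have [A hA dA] : exists2 A : R, A < 0 & `|h i j - A| < e.
    by case/or4P: neg => neg; eexists; try exact: neg; apply: close; rewrite !leqnn ?leqnSn.
  have [A' hA' dA'] : exists2 A : R, 0 <= A & `|h i j - A| < e.
    by move: pos; rewrite !negb_and -!leNgt => /or4P[] pos; eexists; try exact: pos;
      apply: close; rewrite !leqnn ?leqnSn.
  move: dA dA'; rewrite !ltr_norml => /andP[_ lo] /andP[hi _].
  by clear -hA hA' lo hi; apply/andP; split; lra.
exists (grid n N i), (grid n P j); split.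
- exact/xle/ltnW.
- exact/xle/ltnW.
- by apply: (small f) mf => i' j' hi hj; have [] := close i' j' hi hj.
- by apply: (small g) mg => i' j' hi hj; have [] := close i' j' hi hj.
Qed.

End PoincareMiranda.

(** * Euler polygons *)

Section UnifCont.
Variable R : realType.

Definition unif_cont (f : R -> R) := forall e : R, 0 < e -> exists2 d : R, 0 < d &
  forall x y, `|x - y| < d -> `|f x - f y| < e.

Lemma unif_cont2_fst : unif_cont2 (fun c _ : R => c).
Proof. by move=> e e0; exists e. Qed.

Lemma unif_cont2_snd : unif_cont2 (fun _ p : R => p).
Proof. by move=> e e0; exists e. Qed.

Lemma unif_cont2D (F G : R -> R -> R) : unif_cont2 F -> unif_cont2 G ->
  unif_cont2 (fun c p => F c p + G c p).
Proof.
move=> Fu Gu e e0; have e2 : 0 < e / 2 by rewrite divr_gt0.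
have [dF dF0 {}Fu] := Fu _ e2; have [dG dG0 {}Gu] := Gu _ e2.
exists (Num.min dF dG); first by rewrite lt_min dF0.
move=> c c' p p'; rewrite !lt_min => /andP[cF cG] /andP[pF pG].
rewrite opprD addrACA (splitr e); apply: le_lt_trans (ler_normD _ _) _.
by apply: ltrD; [exact: Fu|exact: Gu].
Qed.

Lemma unif_cont2_comp (f : R -> R) (F : R -> R -> R) : unif_cont f ->
  unif_cont2 F -> unif_cont2 (fun c p => f (F c p)).
Proof.
move=> fu Fu e e0; have [d d0 {}fu] := fu _ e0; have [d' d'0 {}Fu] := Fu _ d0.
by exists d' => // c c' p p' hc hp; apply/fu/Fu.
Qed.

Lemma unif_cont2_max (F G : R -> R -> R) : unif_cont2 F -> unif_cont2 G ->
  unif_cont2 (fun c p => Num.max (F c p) (G c p)).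
Proof.
move=> Fu Gu e e0; have [dF dF0 {}Fu] := Fu _ e0; have [dG dG0 {}Gu] := Gu _ e0.
exists (Num.min dF dG); first by rewrite lt_min dF0.
move=> c c' p p'; rewrite !lt_min => /andP[cF cG] /andP[pF pG].
have := Fu _ _ _ _ cF pF; have := Gu _ _ _ _ cG pG.
rewrite !ltr_norml => /andP[g1 g2] /andP[f1 f2]; clear -g1 g2 f1 f2.
by case: (ltP (F c p) (G c p)) => h1; case: (ltP (F c' p') (G c' p')) => h2; apply/andP; split; lra.
Qed.

Lemma lipschitz_unif_cont (f : R -> R) (k : R) :
  (forall x y, `|f x - f y| <= k * `|x - y|) -> unif_cont f.
Proof.
move=> fk e e0; have k1 : 0 < `|k| + 1 by rewrite ltr_pwDr.
exists (e / (`|k| + 1)); first by rewrite divr_gt0.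
move=> x y; rewrite ltr_pdivlMr // mulrC; apply: le_lt_trans.
apply: le_trans (fk x y) _; apply: ler_wpM2r => //.
by rewrite (le_trans (ler_norm k)) // lerDl.
Qed.

End UnifCont.

Section Euler.
Variable R : realType.
Variables (H g : R -> R) (al : nat -> R) (tau : R).

Fixpoint euler (c p : R) (k : nat) : R * R :=
  if k is k'.+1 then
    let: (u, y) := euler c p k' in
    (u + tau * (y - H u), y - tau * (al k' * g u))
  else (c, p).

Fixpoint euler_max (c p : R) (k : nat) : R :=
  if k is k'.+1 then Num.max (euler_max c p k') (euler c p k).1 else c.

Lemma euler1S c p k : (euler c p k.+1).1 =
  (euler c p k).1 + tau * ((euler c p k).2 - H (euler c p k).1).
Proof. by rewrite /=; case: (euler c p k). Qed.

Lemma euler2S c p k : (euler c p k.+1).2 =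
  (euler c p k).2 + tau * (- (al k * g (euler c p k).1)).
Proof. by rewrite /= mulrN; case: (euler c p k). Qed.

Lemma euler_max_ge c p n k : (k <= n)%N -> (euler c p k).1 <= euler_max c p n.
Proof.
elim: n => [|n IH]; first by rewrite leqn0 => /eqP->.
rewrite leq_eqVlt => /orP[/eqP->|]; first by rewrite [leRHS]/= le_max lexx orbT.
by move=> /IH kn; rewrite [leRHS]/= le_max kn.
Qed.

Lemma euler_max_attained c p n :
  exists2 k, (k <= n)%N & euler_max c p n = (euler c p k).1.
Proof.
elim: n => [|n [k kn e]]; first by exists 0%N.
rewrite [euler_max _ _ _]/=; case: (leP (euler_max c p n) _) => _; first by exists n.+1.
by exists k => //; exact: leqW.
Qed.

Hypotheses (Hu : unif_cont H) (gu : unif_cont g).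

Lemma euler_unif_cont k : unif_cont2 (fun c p => (euler c p k).1) /\
  unif_cont2 (fun c p => (euler c p k).2).
Proof.
have scale b : @unif_cont R (fun x => b * x).
  by apply: (@lipschitz_unif_cont _ _ `|b|) => x y; rewrite -mulrBr normrM.
elim: k => [|k [IH1 IH2]]; first by split; [exact: unif_cont2_fst|exact: unif_cont2_snd].
have eq1 : (fun c p => (euler c p k.+1).1) = (fun c p => (euler c p k).1 +
    tau * ((euler c p k).2 + -1 * H (euler c p k).1)).
  by apply/funext => c; apply/funext => p; rewrite euler1S mulN1r.
have eq2 : (fun c p => (euler c p k.+1).2) = (fun c p => (euler c p k).2 +
    (- tau * al k) * g (euler c p k).1).
  by apply/funext => c; apply/funext => p; rewrite euler2S mulrN mulNr mulNr mulrA.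
rewrite eq1 eq2; split; apply: unif_cont2D => //.
  apply: (unif_cont2_comp (scale tau)); apply: unif_cont2D => //.
  by apply: (unif_cont2_comp (scale (-1))); exact: (unif_cont2_comp Hu).
by apply: (unif_cont2_comp (scale _)); exact: (unif_cont2_comp gu).
Qed.

Lemma euler_max_unif_cont k : unif_cont2 (fun c p => euler_max c p k).
Proof.
elim: k => [|k IH]; first exact: unif_cont2_fst.
have [h _] := euler_unif_cont k.+1; exact: (unif_cont2_max IH h).
Qed.

Variables (n : nat) (T A Gm Hm : R).
Hypotheses (n0 : (0 < n)%N) (tau0 : 0 < tau) (nT : tau * n%:R = T).
Hypotheses (alA : forall k, `|al k| <= A) (gG : forall s, `|g s| <= Gm).
Hypotheses (HH : forall s, `|H s| <= Hm).

(** The bound is independent of the start and of [H], because [g] is bounded by [Gm]. *)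
Lemma euler_drift c p k : (k <= n)%N -> `|(euler c p k).2 - p| <= A * Gm * T.
Proof.
have A0 : 0 <= A by apply: le_trans (alA 0); exact: normr_ge0.
have G0 : 0 <= Gm by apply: le_trans (gG 0); exact: normr_ge0.
move=> kn; apply: (@le_trans _ _ (A * Gm * (tau * k%:R))); last first.
  by rewrite ler_wpM2l ?mulr_ge0 // -nT ler_wpM2l ?(ltW tau0) // ler_nat.
elim: k {kn} => [|k IH]; first by rewrite subrr normr0 !mulr0.
rewrite euler2S -[k.+1]addn1 natrD mulrDr mulrDr addrAC.
apply: le_trans (ler_normD _ _) _; apply: lerD => //.
rewrite normrM normrN normrM (gtr0_norm tau0) mulr1 mulrC ler_wpM2r ?(ltW tau0) //.
by apply: ler_pM.
Qed.

Lemma euler_travel c p k : (k <= n)%N ->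
  `|(euler c p k).1 - c| <= (`|p| + A * Gm * T + Hm) * T.
Proof.
have H0 : 0 <= Hm by apply: le_trans (HH 0); exact: normr_ge0.
have C0 : 0 <= A * Gm * T by apply: le_trans (euler_drift 0 0 (leq0n n)).
move=> kn; apply: (@le_trans _ _ ((`|p| + A * Gm * T + Hm) * (tau * k%:R))); last first.
  by rewrite ler_wpM2l ?addr_ge0 // -nT ler_wpM2l ?(ltW tau0) // ler_nat.
elim: k kn => [|k IH] kn; first by rewrite subrr normr0 !mulr0.
rewrite euler1S -[k.+1]addn1 natrD ![in leRHS]mulrDr addrAC.
apply: le_trans (ler_normD _ _) _; apply: lerD; first exact/IH/ltnW.
rewrite normrM (gtr0_norm tau0) mulr1 mulrC ler_wpM2r ?(ltW tau0) //.
apply: le_trans (ler_normB _ _) _; apply: lerD => //.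
rewrite -[X in `|X|](addrNK p) addrC; apply: le_trans (ler_normD _ _) _.
by rewrite lerD2l euler_drift // ltnW.
Qed.

(** Starting from [y = P] or [y = - P], the velocity [y - H u] keeps its sign along the whole
    polygon in spite of the drift of [y]. [D] bounds the displacement of [u] when [|p| <= P]. *)
Let P := A * Gm * T + Hm + 1.
Let D := (P + A * Gm * T + Hm) * T.

(** Poincaré-Miranda on [|c| <= N], [|p| <= P]. At [p = - P] and [p = P] the velocity has a constant
    sign; at [c = - N] all nodes stay below [- N + D], at [c = N] the maximum is at least [N], and
    [phi] beats the drift of [y]. *)
Lemma euler_almost_periodic (phi : R -> R) (N : R) : 0 < N -> unif_cont phi ->
  (forall m, m <= - N + D -> A * Gm * T < phi m) ->
  (forall m, N <= m -> phi m < - (A * Gm * T)) ->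
  forall e : R, 0 < e -> exists c p, [/\ `|c| <= N, `|p| <= P,
    `|(euler c p n).1 - c| < e &
    `|(euler c p n).2 - p + phi (euler_max c p n)| < e].
Proof.
move=> N0 phiu phi_lo phi_hi.
have H0 : 0 <= Hm by apply: le_trans (HH 0); exact: normr_ge0.
have C0 : 0 <= A * Gm * T by apply: le_trans (euler_drift 0 0 (leq0n n)).
have P0 : 0 < P by rewrite ltr_wpDl // addr_ge0.
have neg : @unif_cont R -%R.
  by apply: (@lipschitz_unif_cont _ _ 1) => x y; rewrite -opprD normrN mul1r.
have [u1 u2] := euler_unif_cont n.
apply: (poincare_miranda N0 P0).
- by apply: unif_cont2D => //; apply: (unif_cont2_comp neg); exact: unif_cont2_fst.
- apply: unif_cont2D; last exact: (unif_cont2_comp phiu (euler_max_unif_cont n)).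
  by apply: unif_cont2D => //; apply: (unif_cont2_comp neg); exact: unif_cont2_snd.
(* The strict sign fails at [k = 0], so the induction really starts at the first step. *)
- move=> c _; suff: forall k, (k <= n)%N -> (0 < k)%N ->
    (euler c (- P) k).1 - c < 0 by apply.
  elim=> [//|k IH] kn _; rewrite euler1S.
  have step : (euler c (- P) k).2 - H (euler c (- P) k).1 < 0.
    have := euler_drift c (- P) (ltnW kn); have := HH (euler c (- P) k).1.
    rewrite !ler_norml => /andP[h1 _] /andP[_ h2].
    by rewrite /P in h2 *; lra.
  have : tau * ((euler c (- P) k).2 - H (euler c (- P) k).1) < 0.
    by rewrite pmulr_rlt0.
  move: IH; case: k kn {step} => [|k] kn IH; first by rewrite /= addrAC subrr add0r.
  by move=> h; rewrite addrAC -[0]addr0 ltrD // IH // ltnW.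
- move=> c _; suff: forall k, (k <= n)%N -> 0 <= (euler c P k).1 - c by apply.
  elim=> [|k IH] kn; first by rewrite subrr.
  rewrite euler1S addrAC addr_ge0 ?IH ?(ltnW kn) // mulr_ge0 ?(ltW tau0) //.
  have := euler_drift c P (ltnW kn); have := HH (euler c P k).1.
  rewrite !ler_norml => /andP[_ h1] /andP[h2 _].
  by rewrite /P in h2 *; lra.
- move=> p pP; have [k kn ->] := euler_max_attained (- N) p n.
  have /phi_lo : (euler (- N) p k).1 <= - N + D.
    have := euler_travel (- N) p kn; rewrite ler_norml lerBlDl => /andP[_ h].
    apply: le_trans h _; rewrite lerD2l /D ler_wpM2r //; last by rewrite !lerD2r.
    by rewrite -nT mulr_ge0 // ltW.
  have := euler_drift (- N) p (leqnn n); rewrite ler_norml => /andP[h1 _] h2.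
  by lra.
- move=> p pP; have /phi_hi := euler_max_ge N p (leq0n n).
  have := euler_drift N p (leqnn n); rewrite ler_norml => /andP[_ h1] h2.
  by lra.
Qed.

End Euler.

(** * Limits of Euler polygons *)

Section Clamp.
Variable R : realType.
Implicit Types b x y : R.

Definition clamp b x := Num.max 0 (Num.min x b).

Lemma clamp_itv b x : 0 <= b -> 0 <= clamp b x <= b.
Proof. by move=> b0; rewrite /clamp le_max lexx /= ge_max b0 ge_min lexx orbT. Qed.

Lemma clamp_id b x : 0 <= x <= b -> clamp b x = x.
Proof. by move=> /andP[x0 xb]; rewrite /clamp min_l // max_r. Qed.

Lemma clamp_le0 b x : x <= 0 -> clamp b x = 0.
Proof. by move=> x0; rewrite /clamp max_l // ge_min x0. Qed.

Lemma clamp_dist b x y : 0 <= b -> `|clamp b x - clamp b y| <= `|x - y|.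
Proof.
move=> b0; rewrite /clamp.
have [x1|x1] := leP x b; have [y1|y1] := leP y b; rewrite ?(max_r b0).
all: try have [x2|x2] := leP 0 x; try have [y2|y2] := leP 0 y; rewrite ?subrr ?normr0 //.
all: rewrite ler_norml; have := ler_norm (x - y); have := ler_norm (y - x);
  rewrite distrC => h1 h2; apply/andP; split; lra.
Qed.

End Clamp.

Section UltraLimit.
Variables (R : realType) (F : set_system nat).
Hypothesis FU : UltraFilter F.

(** Along an ultrafilter every bounded sequence converges: limits at all times are taken at once,
    without extracting subsequences. *)
Lemma ultra_lim (f : nat -> R) (B : R) : (forall n, `|f n| <= B) ->
  exists l, forall e : R, 0 < e -> F [set n | `|f n - l| < e].
Proof.
move=> fB.
have FfB : (f @ F) `[- B, B]%classic.
  suff: F [set n | `[- B, B]%classic (f n)] by [].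
  by apply: filterE => n; rewrite /= in_itv /= -ler_norml.
have [l [_ cl]] := @segment_compact _ (- B) B (f @ F) _ FfB.
exists l => e e0.
have [//|Fn] := in_ultra_setVsetC [set n | `|f n - l| < e] FU.
have [z [/= z1 z2]] := cl (~` [set z | `|z - l| < e]) (ball l e) Fn (nbhsx_ballx _ _ e0).
by case: z1; rewrite distrC.
Qed.

Variable T : R.
Hypothesis T0 : 0 < T.

(** The last node not after [t] among [n.+1] steps; it is [n.+1] at [t = T]. Times outside [[0, T]]
    are projected. *)
Definition time_index n (t : R) := Num.truncn (clamp T t / (T / n.+1%:R)).

Let tau_gt0 n : 0 < T / n.+1%:R. Proof. by rewrite divr_gt0 // ltr0n. Qed.

Lemma time_index_itv n t :
  (time_index n t)%:R * (T / n.+1%:R) <= clamp T t <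
  (time_index n t).+1%:R * (T / n.+1%:R).
Proof.
rewrite -ler_pdivlMr // -ltr_pdivrMr //; apply: truncn_itv.
by rewrite divr_ge0 // ?(ltW (tau_gt0 _)) //; case/andP: (clamp_itv t (ltW T0)).
Qed.

Lemma time_index_le n t : (time_index n t <= n.+1)%N.
Proof.
rewrite truncn_le_nat ltr_pdivrMr // mulrCA; case/andP: (clamp_itv t (ltW T0)) => _ h.
apply: le_lt_trans h _; rewrite ltr_pMr // ltr_pdivlMr ?ltr0n // mul1r.
by rewrite ltr_nat.
Qed.

Lemma time_index_homo n s t : s <= t -> (time_index n s <= time_index n t)%N.
Proof.
move=> st; rewrite truncn_ge_nat; last first.
  by rewrite divr_ge0 // ?(ltW (tau_gt0 _)) //; case/andP: (clamp_itv t (ltW T0)).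
rewrite ler_pdivlMr //; case/andP: (time_index_itv n s) => h _; apply: le_trans h _.
have [h|h] := leP s t; last by move: (lt_le_trans h st); rewrite ltxx.
by rewrite /clamp le_max2 // le_min2.
Qed.

Lemma time_index_grid n k : (k <= n.+1)%N ->
  time_index n (k%:R * (T / n.+1%:R)) = k.
Proof.
move=> kn; have kT : 0 <= k%:R * (T / n.+1%:R) <= T.
  rewrite mulr_ge0 //= ?(ltW (tau_gt0 _)) // mulrCA ger_pMr // ler_pdivrMr ?ltr0n //.
  by rewrite mul1r ler_nat.
by rewrite /time_index clamp_id // mulfK ?gt_eqF //; apply: truncn_def; rewrite lexx ltr_nat /=.
Qed.

Lemma time_index_dist n s t :
  `|(time_index n s)%:R - (time_index n t)%:R| * (T / n.+1%:R) <=
  `|s - t| + T / n.+1%:R.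
Proof.
have := clamp_dist s t (ltW T0); have := tau_gt0 n.
have := time_index_itv n s; have := time_index_itv n t.
move: (T / n.+1%:R) (time_index n s) (time_index n t) (clamp T s) (clamp T t) =>
  tau i j cs ct.
rewrite -[i.+1]addn1 -[j.+1]addn1 !natrD.
move: (i%:R : R) (j%:R : R) (`|s - t|) => {}i {}j d /andP[j1 j2] /andP[i1 i2] tau0.
rewrite ler_norml => /andP[d1 d2].
have -> : `|i - j| * tau = `|(i - j) * tau| by rewrite normrM (gtr0_norm tau0).
by rewrite ler_norml; apply/andP; split; rewrite mulrBl; move: j2 i2; rewrite !mulrDl !mul1r; lra.
Qed.

Hypothesis Foo : \oo `<=` F.

Lemma small_step (e : R) : 0 < e -> F [set n | T / n.+1%:R < e].
Proof.
move=> e0; apply: Foo; exists (Num.truncn (T / e)) => // n /= Nn.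
rewrite ltr_pdivrMr ?ltr0n // mulrC -ltr_pdivrMr //.
by apply: lt_le_trans (truncnS_gt _) _; rewrite ler_nat ltnS.
Qed.

Section DiscreteLimit.
Variables (X : nat -> nat -> R) (B L : R).
Hypothesis XB : forall n k, (k <= n.+1)%N -> `|X n k| <= B.
Hypothesis XL : forall n k, (k < n.+1)%N ->
  `|X n k.+1 - X n k| <= L * (T / n.+1%:R).

Lemma discrete_lipschitz n i j : (i <= n.+1)%N -> (j <= n.+1)%N ->
  `|X n i - X n j| <= L * (`|i%:R - j%:R| * (T / n.+1%:R)).
Proof.
wlog ij : i j / (i <= j)%N.
  move=> H; case: (leqP i j) => [ij|/ltnW ij] ? ?; first exact: H.
  by rewrite distrC (distrC _ j%:R); apply: H.
move=> _ /= jn; rewrite -(subnKC ij) in jn *; move: (j - i)%N jn => d {ij}.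
elim: d => [|d IH] jn; first by rewrite addn0 !subrr normr0 mul0r mulr0.
rewrite addnS in jn *; rewrite -(subrKA (X n (i + d)%N)).
apply: le_trans (ler_normD _ _) _.
have -> : `|i%:R - (i + d).+1%:R| = `|i%:R - (i + d)%:R| + 1 :> R.
  rewrite -[(i + d).+1]addn1 !natrD !opprD !addrA subrr sub0r -opprD !normrN.
  by rewrite !ger0_norm.
by rewrite mulrDl mulrDr mul1r lerD ?IH ?(ltnW jn) // distrC XL.
Qed.

Lemma discrete_limit : 0 <= L -> exists x : R -> R,
  (forall s t, `|x s - x t| <= L * `|s - t|) /\
  forall e : R, 0 < e -> F [set n | forall t, `|X n (time_index n t) - x t| <= e].
Proof.
move=> L0.
have pt t : exists l, forall e : R, 0 < e ->
    F [set n | `|X n (time_index n t) - l| < e].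
  by apply: (@ultra_lim _ B) => n; apply/XB/time_index_le.
have [x xP] := choice pt.
have Xst n s t : `|X n (time_index n s) - X n (time_index n t)| <=
    L * (`|s - t| + T / n.+1%:R).
  apply: le_trans (discrete_lipschitz (time_index_le n s) (time_index_le n t)) _.
  by apply: ler_wpM2l => //; exact: time_index_dist.
have xL s t : `|x s - x t| <= L * `|s - t|.
  suff key (e : R) : 0 < e -> `|x s - x t| <= L * `|s - t| + e by exact/ler_addgt0Pr.
  move=> e0; have e3 : 0 < e / 3 by rewrite divr_gt0.
  have eL : 0 < e / 3 / (L + 1) by rewrite divr_gt0 // ltr_wpDl.
  have [n [[/= h1 h2] h3]] := filter_ex
    (filterI (filterI (xP s _ e3) (xP t _ e3)) (small_step eL)).
  have := Xst n s t; rewrite mulrDr => h4.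
  have h5 : L * (T / n.+1%:R) <= e / 3.
    apply: (@le_trans _ _ (L * (e / 3 / (L + 1)))); first by rewrite ler_wpM2l // ltW.
    rewrite mulrCA ger_pMr // ler_pdivrMr ?ltr_wpDl // mul1r lerDl //.
  have -> : x s - x t = - (X n (time_index n s) - x s) +
    (X n (time_index n t) - x t) + (X n (time_index n s) - X n (time_index n t)).
    by ring.
  apply: le_trans (ler_normD _ _) _; apply: le_trans (lerD (ler_normD _ _) (lexx _)) _.
  by rewrite normrN; move: (L * (T / n.+1%:R)) h1 h2 h4 h5 => ?; lra.
exists x; split=> // e e0.
have e4 : 0 < e / 4 by rewrite divr_gt0.
have eL : 0 < e / 4 / (L + 1) by rewrite divr_gt0 // ltr_wpDl.
(* A coarse mesh fixed before [n]; convergence at its finitely many nodes is simultaneous. *)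
have [m mP] : exists m : nat, L * (T / m.+1%:R) <= e / 4.
  have [m /= mP] := filter_ex (small_step eL); exists m.
  apply: (@le_trans _ _ (L * (e / 4 / (L + 1)))); first by rewrite ler_wpM2l // ltW.
  by rewrite mulrCA ger_pMr // ler_pdivrMr ?ltr_wpDl // mul1r lerDl.
pose node (j : 'I_m.+2) := j%:R * (T / m.+1%:R) : R.
have FN : F [set n | forall j, `|X n (time_index n (node j)) - x (node j)| < e / 4].
  by apply: filter_forall => j; exact: xP.
apply: filterS (filterI FN (small_step eL)) => n [/= nodes taun] t.
have taue : L * (T / n.+1%:R) <= e / 4.
  apply: (@le_trans _ _ (L * (e / 4 / (L + 1)))); first by rewrite ler_wpM2l // ltW.
  by rewrite mulrCA ger_pMr // ler_pdivrMr ?ltr_wpDl // mul1r lerDl.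
have idx_clamp k : time_index k t = time_index k (clamp T t).
  by rewrite /time_index (clamp_id (clamp_itv _ (ltW T0))).
(* [time_index] sees only the projection of [t], so the limit is constant beyond the ends of
   [[0, T]]. *)
have xt : x t = x (clamp T t).
  apply/eqP; rewrite -subr_eq0 -normr_le0.
  suff key (d : R) : 0 < d -> `|x t - x (clamp T t)| <= 0 + d by exact/ler_addgt0Pr.
  move=> d0; have d2 : 0 < d / 2 by rewrite divr_gt0.
  have [k [/= h1 h2]] := filter_ex (filterI (xP t _ d2) (xP (clamp T t) _ d2)).
  rewrite idx_clamp in h1; rewrite add0r (splitr d).
  move: (X k (time_index k (clamp T t))) h1 h2 => X0 h1 h2.
  rewrite -(subrKA X0); apply: le_trans (ler_normD _ _) _.
  by apply: lerD; apply: ltW; rewrite // distrC.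
rewrite xt idx_clamp; move: (clamp T t) (clamp_itv t (ltW T0)) => {xt idx_clamp}t tT.
have jm : (time_index m t < m.+2)%N by rewrite ltnS time_index_le.
have /andP[n1 n2] := time_index_itv m t; rewrite (clamp_id tT) in n1 n2.
have := nodes (Ordinal jm); rewrite /node /=; set tj := _ * _ => h1.
have tjt : `|t - tj| <= T / m.+1%:R.
  rewrite ger0_norm ?subr_ge0 // lerBlDr /tj addrC -[X in _ + X]mul1r -mulrDl.
  by rewrite natr1 ltW.
have h2 := Xst n t tj; have h3 := xL tj t.
have h4 : L * `|t - tj| <= e / 4 by apply: le_trans mP; rewrite ler_wpM2l.
rewrite mulrDr in h2; rewrite distrC in h3.
(* Four errors of size [e / 4]: one fine step, the coarse mesh for [X], convergence at the node, the
   coarse mesh for [x]. *)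
have -> : X n (time_index n t) - x t = (X n (time_index n t) - X n (time_index n tj))
  + (X n (time_index n tj) - x tj) - (x t - x tj) by ring.
apply: le_trans (ler_normB _ _) _; apply: le_trans (lerD (ler_normD _ _) (lexx _)) _.
rewrite (distrC (x t)) (distrC tj t) in h3 *.
by move: (L * (T / n.+1%:R)) h1 h2 h3 h4 taue => ?; lra.
Qed.

End DiscreteLimit.

End UltraLimit.

(** * Darboux primitives *)

Section Primitive.
Variable R : realType.
Implicit Types (f F : R -> R) (a b s t x k : R).

(* [f] may be discontinuous; as it is tested on open intervals only, its values
   at isolated points are immaterial. *)
Definition primitive f F a b := forall s t k, a <= s -> s <= t -> t <= b ->
  ((forall x, s < x < t -> f x <= k) -> F t - F s <= k * (t - s)) /\
  ((forall x, s < x < t -> k <= f x) -> k * (t - s) <= F t - F s).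

Lemma primitive_le f F a b s t k : primitive f F a b -> a <= s -> s <= t -> t <= b ->
  (forall x, s < x < t -> f x <= k) -> F t - F s <= k * (t - s).
Proof. by move=> h h1 h2 h3 h4; have [+ _] := h s t k h1 h2 h3; apply. Qed.

Lemma primitive_ge f F a b s t k : primitive f F a b -> a <= s -> s <= t -> t <= b ->
  (forall x, s < x < t -> k <= f x) -> k * (t - s) <= F t - F s.
Proof. by move=> h h1 h2 h3 h4; have [_] := h s t k h1 h2 h3; apply. Qed.

Lemma primitive_bound f F a b s t k : primitive f F a b -> a <= s -> s <= t -> t <= b ->
  (forall x, s < x < t -> `|f x| <= k) -> `|F t - F s| <= k * (t - s).
Proof.
move=> h h1 h2 h3 h4; rewrite ler_norml -mulNr; apply/andP; split.
  by apply: (primitive_ge h) => // x /h4; rewrite ler_norml => /andP[].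
by apply: (primitive_le h) => // x /h4; rewrite ler_norml => /andP[].
Qed.

Lemma primitiveN f F a b : primitive f F a b ->
  primitive (fun x => - f x) (fun x => - F x) a b.
Proof.
move=> h s t k h1 h2 h3; split => h4.
  rewrite -opprD -lerN2 opprK -mulNr; apply: (primitive_ge h) => // x /h4.
  by rewrite lerNl.
rewrite -opprD -lerN2 opprK -mulNr; apply: (primitive_le h) => // x /h4.
by rewrite lerNr.
Qed.

Lemma primitive_sub f F a b a' b' : primitive f F a b -> a <= a' -> b' <= b ->
  primitive f F a' b'.
Proof.
move=> h aa bb s t k h1 h2 h3.
by apply: h => //; [exact: le_trans aa h1|exact: le_trans h3 bb].
Qed.

Lemma primitive_eq f F f' F' a b : primitive f F a b ->
  (forall x, a < x < b -> f' x = f x) -> (forall x, a <= x <= b -> F' x = F x) ->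
  primitive f' F' a b.
Proof.
move=> h ff FF s t k h1 h2 h3; have [hle hge] := h s t k h1 h2 h3.
have st x : s < x < t -> f' x = f x.
  move=> /andP[sx xt]; apply: ff.
  by rewrite (le_lt_trans h1 sx) (lt_le_trans xt h3).
rewrite !FF ?h1 ?(le_trans h2 h3) ?(le_trans h1 h2) //.
by split => h4; [apply: hle|apply: hge] => x sxt; rewrite -st //; exact: h4.
Qed.

Lemma primitive_shift f F a b c : primitive f F (a + c) (b + c) ->
  primitive (fun x => f (x + c)) (fun x => F (x + c)) a b.
Proof.
move=> h s t k h1 h2 h3.
have -> : t - s = (t + c) - (s + c) by ring.
have [] := h (s + c) (t + c) k; rewrite ?lerD2r // => hle hge.
split => h4; [apply: hle|apply: hge] => x;
  by rewrite -ltrBlDr -(ltrBrDr s) => sxt; have := h4 (x - c) sxt; rewrite subrK.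
Qed.

Lemma primitive_cat f F a b c : a <= b -> b <= c ->
  primitive f F a b -> primitive f F b c -> primitive f F a c.
Proof.
move=> ab bc h1 h2 s t k as_ st tc.
have [tb|bt] := leP t b; first exact: h1.
have [bs|sb] := leP b s; first exact: h2.
have -> : F t - F s = (F t - F b) + (F b - F s) by ring.
have -> : k * (t - s) = k * (t - b) + k * (b - s) by ring.
split => h4; apply: lerD.
- by apply: (primitive_le h2); rewrite ?(ltW bt) // => x /andP[? ?];
    apply: h4; apply/andP; split => //; exact: lt_trans sb _.
- by apply: (primitive_le h1); rewrite ?(ltW sb) // => x /andP[? ?];
    apply: h4; apply/andP; split => //; exact: lt_trans bt.
- by apply: (primitive_ge h2); rewrite ?(ltW bt) // => x /andP[? ?];
    apply: h4; apply/andP; split => //; exact: lt_trans sb _.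
- by apply: (primitive_ge h1); rewrite ?(ltW sb) // => x /andP[? ?];
    apply: h4; apply/andP; split => //; exact: lt_trans bt.
Qed.

Lemma continuous_dist f x (e : R) : {for x, continuous f} -> 0 < e ->
  exists2 d : R, 0 < d & forall y, `|y - x| < d -> `|f y - f x| < e.
Proof.
move=> /cvgrPdist_lt /(_ e) h /h /nbhs_ballP[d /= d0 hd]; exists d => // y yx.
by rewrite distrC; apply: hd; rewrite /ball /= distrC.
Qed.

Lemma dist_continuous f x : (forall e : R, 0 < e -> exists2 d : R, 0 < d &
  forall y, `|y - x| < d -> `|f y - f x| < e) -> {for x, continuous f}.
Proof.
move=> h; apply/cvgrPdist_lt => e e0; have [d d0 hd] := h _ e0.
apply/nbhs_ballP; exists d => //= y; rewrite /ball /= distrC => /hd.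
by rewrite distrC.
Qed.

Lemma lipschitz_continuous f k : (forall s t, `|f s - f t| <= k * `|s - t|) ->
  continuous f.
Proof.
move=> /lipschitz_unif_cont h x; apply: dist_continuous => e /h [d d0 hd].
by exists d => // y; apply: hd.
Qed.

(** Near [x] the values of [f] lie between [f x - e] and [f x + e], which serve as the constants [k]
    of [primitive]. *)
Lemma primitive_quotient f F a b x (e : R) : primitive f F a b -> {for x, continuous f} ->
  0 < e -> a <= x <= b -> exists2 d : R, 0 < d & forall y, a <= y <= b ->
    `|y - x| < d -> `|F y - F x - f x * (y - x)| <= e * `|y - x|.
Proof.
move=> h fx e0 /andP[ax xb]; have [d d0 hd] := continuous_dist fx e0.
exists d => // y /andP[ay yb] yx.
have near z s t : s < z < t -> (s = x /\ t = y) \/ (s = y /\ t = x) ->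
    f x - e <= f z <= f x + e.
  move=> /andP[sz zt] st; suff /hd : `|z - x| < d by rewrite ltr_norml => /andP[? ?]; lra.
  apply: le_lt_trans yx; rewrite ler_norml.
  have := ler_norm (y - x); have := ler_norm (x - y); rewrite distrC.
  by case: st sz zt => -[-> ->] *; apply/andP; split; lra.
have [xy|yx'] := leP x y.
  rewrite (ger0_norm (_ : 0 <= y - x)) ?subr_ge0 // ler_norml.
  have h1 : F y - F x <= (f x + e) * (y - x).
    by apply: (primitive_le h) => // z /near /(_ (or_introl (conj erefl erefl))) /andP[].
  have h2 : (f x - e) * (y - x) <= F y - F x.
    by apply: (primitive_ge h) => // z /near /(_ (or_introl (conj erefl erefl))) /andP[].
  by move: h1 h2; rewrite mulrDl mulrBl => h1 h2; apply/andP; split; lra.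
rewrite (distrC y x) (ger0_norm (_ : 0 <= x - y)) ?subr_ge0 ?(ltW yx') // ler_norml.
have h1 : F x - F y <= (f x + e) * (x - y).
  by apply: (primitive_le h); rewrite ?(ltW yx') // => z
    /near /(_ (or_intror (conj erefl erefl))) /andP[].
have h2 : (f x - e) * (x - y) <= F x - F y.
  by apply: (primitive_ge h); rewrite ?(ltW yx') // => z
    /near /(_ (or_intror (conj erefl erefl))) /andP[].
have -> : F y - F x - f x * (y - x) = - (F x - F y) + f x * (x - y) by ring.
by move: h1 h2; rewrite mulrDl mulrBl => h1 h2; apply/andP; split; lra.
Qed.

Lemma primitive_is_derive f F a b x : primitive f F a b -> {for x, continuous f} ->
  a < x < b -> is_derive x (1 : R) F (f x).
Proof.
move=> h fx /andP[ax xb].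
suff cv : (fun e : R => e^-1 *: (F (e *: (1 : R) + x) - F x)) @ 0^' --> f x.
  by apply: DeriveDef; [apply/cvg_ex; exists (f x)|exact: cvg_lim].
apply/cvgrPdist_le => e e0.
have axb : a <= x <= b by rewrite !ltW.
have [d d0 hd] := primitive_quotient h fx e0 axb.
set d' := Num.min d (Num.min (x - a) (b - x)).
have d'0 : 0 < d' by rewrite /d' !lt_min d0 !subr_gt0 ax xb.
apply/nbhs_ballP; exists d' => //= y; rewrite /ball /= sub0r normrN => yd y0.
move: yd; rewrite /d' !lt_min => /and3P[yd ya yb].
have yx : y + x - x = y by rewrite addrK.
have hy : a <= y + x <= b.
  move: ya yb; rewrite !ltr_norml => /andP[? ?] /andP[? ?].
  by apply/andP; split; lra.
have := hd _ hy; rewrite yx => /(_ yd) hF.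
have -> : y%:A = y by rewrite /GRing.scale /= mulr1.
have yn : `|y| != 0 by rewrite normr_eq0.
rewrite -(ler_pM2r (_ : 0 < `|y|)) ?normr_gt0 // -normrM mulrBl distrC.
by rewrite /GRing.scale /= mulrAC mulVf // mul1r.
Qed.

Lemma primitive_is_derive_within f F a b x : primitive f F a b ->
  {for x, continuous f} -> a <= x <= b -> is_derive_within `[a, b] F x (f x).
Proof.
move=> h fx axb; apply/cvgrPdist_le => e e0.
have [d d0 hd] := primitive_quotient h fx e0 axb.
rewrite /within /=; apply/nbhs_ballP; exists d => //= y; rewrite /ball /= => yd y0 yab.
rewrite in_itv /= in yab.
have yx : y - x != 0 by rewrite subr_eq0.
rewrite distrC in yd; have hF := hd _ yab yd.
rewrite -(ler_pM2r (_ : 0 < `|y - x|)) ?normr_gt0 // -normrM mulrBl distrC.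
by rewrite mulfVK.
Qed.

(** A one-sided form of the sign of the derivative, so that it also applies at the end [x = b]. *)
Lemma primitive_above_left f F a b x : primitive f F a b -> {for x, continuous f} ->
  a < x <= b -> 0 < f x -> exists2 y, a <= y < x & F y < F x.
Proof.
move=> h fx /andP[ax xb] fx0; have e0 : 0 < f x / 2 by rewrite divr_gt0.
have axb : a <= x <= b by rewrite ltW.
have [d d0 hd] := primitive_quotient h fx e0 axb.
set y := Num.max a (x - d / 2).
have yx : y < x by rewrite gt_max ax /= ltrBlDr ltrDl divr_gt0.
have ay : a <= y by rewrite le_max lexx.
have dy : x - d / 2 <= y by rewrite le_max lexx orbT.
exists y; first by rewrite ay.
have := hd y; rewrite ay (le_trans (ltW yx)) // => /(_ isT).
rewrite distrC gtr0_norm ?subr_gt0 // => /(_ ltac:(lra)).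
rewrite ler_norml => /andP[_]; have : 0 < f x * (x - y) by rewrite mulr_gt0 ?subr_gt0.
rewrite mulrAC !mulrBr; lra.
Qed.

Lemma primitive_above_right f F a b x : primitive f F a b -> {for x, continuous f} ->
  a <= x < b -> 0 < f x -> exists2 y, x < y <= b & F x < F y.
Proof.
move=> h fx /andP[ax xb] fx0; have e0 : 0 < f x / 2 by rewrite divr_gt0.
have axb : a <= x <= b by rewrite ax ltW.
have [d d0 hd] := primitive_quotient h fx e0 axb.
set y := Num.min b (x + d / 2).
have yx : x < y by rewrite lt_min xb /= ltrDl divr_gt0.
have yb : y <= b by rewrite ge_min lexx.
have dy : y <= x + d / 2 by rewrite ge_min lexx orbT.
exists y; first by rewrite yx.
have := hd y; rewrite yb (le_trans ax (ltW yx)) // => /(_ isT).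
rewrite gtr0_norm ?subr_gt0 // => /(_ ltac:(lra)).
rewrite ler_norml => /andP[+ _]; have : 0 < f x * (y - x) by rewrite mulr_gt0 ?subr_gt0.
rewrite mulrAC !mulrBr; lra.
Qed.

End Primitive.

(** * Solutions by shooting *)

Section HeineCantor.
Variable R : realType.

(** Only [x] is confined to the segment; [y] is any nearby point. Compactness is used as near
    covering, with the filter [0^'+] for the radii. *)
Lemma continuous_unif_cont_itv (f : R -> R) (a b e : R) : continuous f -> 0 < e ->
  exists2 d : R, 0 < d & forall x y, a <= x <= b -> `|y - x| < d -> `|f y - f x| < e.
Proof.
move=> fc e0; have e2 : 0 < e / 2 by rewrite divr_gt0.
have /compact_near_coveringP cov := @segment_compact R a b.
have := cov _ (0 : R)^'+ (fun d x => forall y, `|y - x| < d -> `|f y - f x| < e).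
move=> /(_ _ _) [|d /= d0 hd]; last first.
  exists (d / 2); first by rewrite divr_gt0.
  move=> x y axb; apply: hd; rewrite /= ?in_itv //= ?divr_gt0 //.
  by rewrite sub0r normrN gtr0_norm ?divr_gt0 // ltr_pdivrMr // ltr_pMr // ltr1n.
move=> x _; have [d d0 hd] := continuous_dist (fc x) e2.
have d2 : 0 < d / 2 by rewrite divr_gt0.
exists (ball x (d / 2), [set i : R | i < d / 2]).
  split => /=; first exact: nbhsx_ballx.
  exact: nbhs_right_lt.
move=> [x' i] /= [xx' id] y yx'.
have h1 : `|f x' - f x| < e / 2.
  apply: hd; rewrite distrC; apply: lt_trans xx' _.
  by rewrite ltr_pdivrMr // ltr_pMr // ltr1n.
have h2 : `|f y - f x| < e / 2.
  apply: hd; rewrite -(subrKA x') (splitr d); apply: le_lt_trans (ler_normD _ _) _.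
  by apply: ltrD; [exact: lt_trans yx' id|rewrite distrC].
rewrite -(subrKA (f x)) (splitr e); apply: le_lt_trans (ler_normD _ _) _.
by apply: ltrD => //; rewrite distrC.
Qed.

Lemma unif_cont_clamp (f : R -> R) b : 0 <= b -> continuous f ->
  unif_cont (fun x => f (clamp b x)).
Proof.
move=> b0 fc e e0; have [d d0 hd] := continuous_unif_cont_itv 0 b fc e0.
exists d => // x y xy; apply: hd; first exact: clamp_itv.
exact: le_lt_trans (clamp_dist _ _ b0) xy.
Qed.

End HeineCantor.

Section LimitPrimitive.
Variables (R : realType) (F : set_system nat) (T : R).
Hypotheses (FU : UltraFilter F) (T0 : 0 < T) (Foo : \oo `<=` F).

(** Sum the increments of the scheme over the nodes strictly between [s] and [t], where [f <= k];
    the rest is a bounded number of steps. *)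
Lemma discrete_limit_le (X : nat -> nat -> R) (df : nat -> nat -> R) (x f : R -> R)
    (B s t k : R) :
  (forall n i, (i < n.+1)%N -> X n i.+1 = X n i + T / n.+1%:R * df n i) ->
  (forall n i, (i <= n.+1)%N -> `|df n i| <= B) ->
  (forall e : R, 0 < e -> F [set n | forall t, `|X n (time_index T n t) - x t| <= e]) ->
  (forall e : R, 0 < e -> F [set n | forall i, (i <= n.+1)%N ->
     `|df n i - f (i%:R * (T / n.+1%:R))| <= e]) ->
  0 <= s -> s <= t -> t <= T -> (forall x, s < x < t -> f x <= k) ->
  x t - x s <= k * (t - s).
Proof.
move=> Xrec dfB xX fdf s0 st tT fk.
have B0 : 0 <= B by apply: le_trans (dfB 0%N 0%N isT).
(* [e * T] comes from the increments, [e] from the stray steps and [2 * e] from replacing [X] by [x]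
   at both ends. *)
suff key (e : R) : 0 < e -> x t - x s <= k * (t - s) + e * (T + 3).
  apply/ler_addgt0Pr => e e0; have T3 : 0 < T + 3 by rewrite addr_gt0.
  by have := key (e / (T + 3)); rewrite divfK ?gt_eqF //; apply; rewrite divr_gt0.
move=> e0; have C0 : 0 < B + `|k| *+ 2 + e *+ 2.
  by rewrite ltr_wpDl ?addr_ge0 ?mulrn_wge0 // pmulrn_lgt0.
have eC : 0 < e / (B + `|k| *+ 2 + e *+ 2) by rewrite divr_gt0.
have [n [[/= hX hf] htau]] := filter_ex
  (filterI (filterI (xX _ e0) (fdf _ e0)) (small_step T Foo eC)).
have hs := hX s; have ht := hX t.
have ij := time_index_homo T0 n st; have jn := time_index_le T0 n t.
have /andP[i1 i2] := time_index_itv T0 n s.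
have /andP[j1 j2] := time_index_itv T0 n t.
rewrite !clamp_id ?s0 ?(le_trans st) ?(le_trans s0 st) // in i1 i2 j1 j2.
have tau0 : 0 < T / n.+1%:R by rewrite divr_gt0 // ltr0n.
rewrite ltr_pdivlMr // in htau.
have {}Xrec := Xrec n; have {}dfB := dfB n.
move: (time_index T n s) (time_index T n t) ij jn i1 i2 j1 j2 hs ht =>
  i j ij jn i1 i2 j1 j2 hs ht.
move: (T / n.+1%:R) tau0 htau Xrec hf i1 i2 j1 j2 => tau tau0 htau Xrec hf i1 i2 j1 j2.
have le_abs m : m * tau <= `|m| * tau by rewrite ler_wpM2r ?(ltW tau0) // ler_norm.
have incr : X n j - X n i <= (k + e) * (t - s) + tau * (B + (`|k| + e) *+ 2).
  move: ij; rewrite leq_eqVlt => /orP[/eqP eij|lij].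
    rewrite -eij subrr in j1 j2 *.
    have h1 : t - s <= tau by rewrite -natr1 mulrDl mul1r in j2; lra.
    have h2 : - ((k + e) * (t - s)) <= (`|k| + e) * tau.
      rewrite -mulNr; apply: le_trans (_ : `|k + e| * (t - s) <= _).
        by rewrite ler_wpM2r ?subr_ge0 // -normrN ler_norm.
      apply: ler_pM => //; first by rewrite subr_ge0.
      by apply: le_trans (ler_normD _ _) _; rewrite (gtr0_norm e0).
    have h3 : 0 <= tau * B by rewrite mulr_ge0 // ltW.
    have h4 : 0 <= (`|k| + e) * tau by rewrite mulr_ge0 ?addr_ge0 // ltW.
    have -> : tau * (B + (`|k| + e) *+ 2) = tau * B + (`|k| + e) * tau *+ 2 by ring.
    lra.
  have first_step : X n i.+1 - X n i <= tau * B.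
    rewrite Xrec ?(leq_trans lij) // addrC addKr ler_wpM2l ?(ltW tau0) //.
    by apply: le_trans (ler_norm _) (dfB _ _); rewrite (leq_trans (ltnW lij)).
  have steps d : (i.+1 + d <= j)%N ->
      X n (i.+1 + d)%N - X n i <= tau * B + (k + e) * (tau * d%:R).
    elim: d => [|d IH] dj; first by rewrite addn0 !mulr0 addr0.
    rewrite addnS in dj *.
    rewrite Xrec ?(leq_trans dj) // addrAC -natr1 mulrDr mulr1 mulrDr addrA.
    apply: lerD; first exact/IH/ltnW.
    rewrite mulrC ler_wpM2r ?(ltW tau0) //.
    have : f ((i.+1 + d)%:R * tau) <= k.
      apply: fk; apply/andP; split.
        apply: lt_le_trans i2 _; rewrite ler_wpM2r ?(ltW tau0) // ler_nat.
        by rewrite addSn ltnS leq_addr.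
      by apply: lt_le_trans _ j1; rewrite ltr_pM2r // ltr_nat.
    have := hf (i.+1 + d)%N; rewrite (leq_trans (ltnW dj)) // => /(_ isT).
    rewrite ler_norml => /andP[_]; lra.
  have := steps (j - i.+1)%N; rewrite subnKC // => /(_ (leqnn _)) h1.
  have : `|tau * (j - i.+1)%:R - (t - s)| <= tau *+ 2.
    rewrite natrB // mulrBr ![tau * _]mulrC -natr1 mulrDl mul1r.
    rewrite -natr1 mulrDl mul1r in j2; rewrite -natr1 mulrDl mul1r in i2.
    by rewrite mulr2n ler_norml; apply/andP; split; lra.
  move=> h2; have h3 : `|k + e| * `|tau * (j - i.+1)%:R - (t - s)| <= (`|k| + e) * (tau *+ 2).
    by apply: ler_pM => //; apply: le_trans (ler_normD _ _) _; rewrite (gtr0_norm e0).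
  rewrite -normrM ler_norml mulrBr in h3; case/andP: h3 => _ h3.
  have -> : tau * (B + (`|k| + e) *+ 2) = tau * B + (`|k| + e) * (tau *+ 2) by ring.
  lra.
have h1 : tau * (B + (`|k| + e) *+ 2) <= e by rewrite mulrnDl addrA ltW.
have h2 : (k + e) * (t - s) <= k * (t - s) + e * T.
  rewrite mulrDl lerD2l ler_wpM2l ?(ltW e0) //; lra.
move: hs ht; rewrite !ler_norml => /andP[_ hs] /andP[ht _]; lra.
Qed.

End LimitPrimitive.

Section Shooting.
Variables (R : realType) (T A Gm Hm N : R) (H g al phi : R -> R).
Hypotheses (T0 : 0 < T) (N0 : 0 < N).
Hypotheses (Hu : unif_cont H) (gu : unif_cont g) (phiu : unif_cont phi).
Hypotheses (alA : forall t, `|al t| <= A) (gG : forall s, `|g s| <= Gm).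
Hypothesis HH : forall s, `|H s| <= Hm.

Let C := A * Gm * T.
Let P := C + Hm + 1.
Let D := (P + C + Hm) * T.

Hypothesis phi_lo : forall m, m <= - N + D -> C < phi m.
Hypothesis phi_hi : forall m, N <= m -> phi m < - C.

(** The boundary errors of the polygons are below their step [tau n] and vanish in the limit; [phi]
    passes to the limit because the maximum over the nodes tends to the maximum of [u]. *)
Lemma shooting : exists (u y : R -> R) (M : R),
  [/\ continuous u /\ continuous y,
      primitive (fun t => y t - H (u t)) u 0 T,
      primitive (fun t => - (al t * g (u t))) y 0 T,
      u T = u 0 /\ y T - y 0 = - phi M &
      (forall t, 0 <= t <= T -> u t <= M) /\ (exists2 t, 0 <= t <= T & u t = M)].
Proof.
(* A single ultrafilter finer than the filter at infinity serves [u] and [y] together. *)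
have [F [FU Foo]] := ultraFilterLemma eventually_filter.
pose tau n := T / n.+1%:R.
have tau0 n : 0 < tau n by rewrite divr_gt0 // ltr0n.
have tauT n : tau n * n.+1%:R = T by rewrite /tau divfK // pnatr_eq0.
pose aln n k := al (k%:R * tau n).
have alnA n k : `|aln n k| <= A by exact: alA.
have approx n : exists cp : R * R, [/\ `|cp.1| <= N, `|cp.2| <= P,
    `|(euler H g (aln n) (tau n) cp.1 cp.2 n.+1).1 - cp.1| < tau n &
    `|(euler H g (aln n) (tau n) cp.1 cp.2 n.+1).2 - cp.2 +
       phi (euler_max H g (aln n) (tau n) cp.1 cp.2 n.+1)| < tau n].
  have [c [p ?]] := euler_almost_periodic Hu gu (ltn0Sn n) (tau0 n) (tauT n)
    (alnA n) gG HH N0 phiu phi_lo phi_hi (tau0 n).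
  by exists (c, p).
have [cp cpP] := choice approx.
pose X n k := (euler H g (aln n) (tau n) (cp n).1 (cp n).2 k).1.
pose Y n k := (euler H g (aln n) (tau n) (cp n).1 (cp n).2 k).2.
have A0 : 0 <= A by apply: le_trans (alA 0); exact: normr_ge0.
have G0 : 0 <= Gm by apply: le_trans (gG 0); exact: normr_ge0.
have H0 : 0 <= Hm by apply: le_trans (HH 0); exact: normr_ge0.
have C0 : 0 <= C by rewrite /C !mulr_ge0 // ltW.
have YB n k : (k <= n.+1)%N -> `|Y n k| <= P + C.
  move=> kn; have [_ pP _ _] := cpP n.
  have := euler_drift H (tau0 n) (tauT n) (alnA n) gG (cp n).1 (cp n).2 kn.
  rewrite -/(Y n k) -/C => h; rewrite -(subrK (cp n).2 (Y n k)) addrC.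
  by apply: le_trans (ler_normD _ _) _; apply: lerD.
have XB n k : (k <= n.+1)%N -> `|X n k| <= N + D.
  move=> kn; have [cN pP _ _] := cpP n.
  have := euler_travel (tau0 n) (tauT n) (alnA n) gG HH (cp n).1 (cp n).2 kn.
  rewrite -/(X n k) -/C => h; rewrite -(subrK (cp n).1 (X n k)) addrC.
  apply: le_trans (ler_normD _ _) _; apply: lerD => //.
  by apply: le_trans h _; rewrite ler_wpM2r ?(ltW T0) // !lerD2r.
have XS n k : X n k.+1 = X n k + T / n.+1%:R * (Y n k - H (X n k)).
  by rewrite /X /Y euler1S.
have YS n k : Y n k.+1 = Y n k + T / n.+1%:R * - (al (k%:R * tau n) * g (X n k)).
  by rewrite /X /Y euler2S.
have dXB n k : (k <= n.+1)%N -> `|Y n k - H (X n k)| <= P + C + Hm.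
  by move=> kn; apply: le_trans (ler_normB _ _) _; apply: lerD; rewrite ?YB.
have dYB n k : (k <= n.+1)%N -> `|- (al (k%:R * tau n) * g (X n k))| <= A * Gm.
  by move=> _; rewrite normrN normrM ler_pM.
have XL n k : (k < n.+1)%N -> `|X n k.+1 - X n k| <= (P + C + Hm) * (T / n.+1%:R).
  move=> kn; rewrite XS addrC addKr normrM (gtr0_norm (tau0 n)) mulrC.
  by rewrite ler_wpM2r ?(ltW (tau0 n)) // dXB // ltnW.
have YL n k : (k < n.+1)%N -> `|Y n k.+1 - Y n k| <= A * Gm * (T / n.+1%:R).
  move=> kn; rewrite YS addrC addKr normrM (gtr0_norm (tau0 n)) mulrC.
  by rewrite ler_wpM2r ?(ltW (tau0 n)) // dYB // ltnW.
have L0 : 0 <= P + C + Hm by rewrite !addr_ge0.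
have [u [uL Xu]] := discrete_limit FU T0 Foo XB XL L0.
have [y [yL Yy]] := discrete_limit FU T0 Foo YB YL (mulr_ge0 A0 G0).
have uc := lipschitz_continuous uL; have yc := lipschitz_continuous yL.
have grid_approx (Z : nat -> nat -> R) (z : R -> R) n (e : R) :
    (forall t, `|Z n (time_index T n t) - z t| <= e) ->
    forall k, (k <= n.+1)%N -> `|Z n k - z (k%:R * tau n)| <= e.
  by move=> h k kn; rewrite -{1}(time_index_grid T0 kn).
have comp_approx (f : R -> R) (e : R) : unif_cont f -> 0 < e ->
    F [set n | forall k, (k <= n.+1)%N -> `|f (X n k) - f (u (k%:R * tau n))| <= e].
  move=> fu e0; have [d d0 fd] := fu e e0.
  have d2 : 0 < d / 2 by rewrite divr_gt0.
  apply: filterS (Xu _ d2) => n /grid_approx h k /h {}h.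
  apply/ltW/fd; apply: le_lt_trans h _.
  by rewrite ltr_pdivrMr // ltr_pMr // ltr1n.
have fX (e : R) : 0 < e -> F [set n | forall k, (k <= n.+1)%N ->
    `|Y n k - H (X n k) - (y (k%:R * tau n) - H (u (k%:R * tau n)))| <= e].
  move=> e0; have e2 : 0 < e / 2 by rewrite divr_gt0.
  apply: filterS (filterI (Yy _ e2) (comp_approx _ _ Hu e2)) => n [/= /grid_approx h1 h2] k kn.
  have -> : Y n k - H (X n k) - (y (k%:R * tau n) - H (u (k%:R * tau n))) =
    (Y n k - y (k%:R * tau n)) - (H (X n k) - H (u (k%:R * tau n))) by ring.
  by rewrite (splitr e); apply: le_trans (ler_normB _ _) _; apply: lerD; [exact: h1|exact: h2].
have fY (e : R) : 0 < e -> F [set n | forall k, (k <= n.+1)%N ->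
    `|- (al (k%:R * tau n) * g (X n k)) -
      - (al (k%:R * tau n) * g (u (k%:R * tau n)))| <= e].
  move=> e0; have eA : 0 < e / (A + 1) by rewrite divr_gt0 // ltr_wpDl.
  apply: filterS (comp_approx _ _ gu eA) => n /= h k kn.
  rewrite opprK addrC -mulrBr normrM distrC.
  apply: (@le_trans _ _ (A * (e / (A + 1)))); first by apply: ler_pM => //; exact: h.
  by rewrite mulrCA ger_pMr // ler_pdivrMr ?ltr_wpDl // mul1r lerDl.
have limit_primitive (Z df : nat -> nat -> R) (z f : R -> R) (B : R) :
    (forall n i, Z n i.+1 = Z n i + T / n.+1%:R * df n i) ->
    (forall n i, (i <= n.+1)%N -> `|df n i| <= B) ->
    (forall e : R, 0 < e -> F [set n | forall t, `|Z n (time_index T n t) - z t| <= e]) ->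
    (forall e : R, 0 < e -> F [set n | forall i, (i <= n.+1)%N ->
       `|df n i - f (i%:R * tau n)| <= e]) ->
    primitive f z 0 T.
  move=> ZS dfB Zz dff s t k s0 st tT; split.
    by apply: (discrete_limit_le FU T0 Foo (X := Z) _ dfB) => // n i _; exact: ZS.
  (* Lower bounds are upper bounds for the opposite functions. *)
  move=> kf; rewrite -lerN2 -mulNr.
  have -> : - (z t - z s) = - z t - - z s by ring.
  apply: (discrete_limit_le FU T0 Foo (X := fun n i => - Z n i)
      (df := fun n i => - df n i) (x := fun t => - z t) (f := fun t => - f t) (B := B)) => //.
  - by move=> n i _; rewrite ZS mulrN opprD.
  - by move=> n i /dfB; rewrite normrN.
  - move=> e e0; apply: filterS (Zz _ e0) => n /= h r.
    by rewrite -opprD normrN.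
  - move=> e e0; apply: filterS (dff _ e0) => n /= h i /h.
    by rewrite -opprD normrN.
  - by move=> r /kf; rewrite lerN2.
have [t0 t0T u_max] := EVT_max (ltW T0) (continuous_subspaceT uc).
have idx0 n : time_index T n 0 = 0%N.
  by rewrite -[RHS](time_index_grid T0 (leq0n n.+1)) mul0r.
have idxT n : time_index T n T = n.+1.
  by rewrite -[RHS](time_index_grid T0 (leqnn n.+1)) mulrC -/(tau n) tauT.
(* One inequality compares the node before [t0] with the discrete maximum, the other compares the
   maximizing node with [u t0]. *)
have max_approx n (e : R) : (forall t, `|X n (time_index T n t) - u t| <= e) ->
    `|euler_max H g (aln n) (tau n) (cp n).1 (cp n).2 n.+1 - u t0| <= e.
  move=> hX; have := euler_max_ge H g (aln n) (tau n) (cp n).1 (cp n).2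
    (time_index_le T0 n t0).
  have [k kn ->] := euler_max_attained H g (aln n) (tau n) (cp n).1 (cp n).2 n.+1.
  have kT : k%:R * tau n \in `[0, T].
    rewrite in_itv /= mulr_ge0 ?(ltW (tau0 n)) //= -[leRHS](tauT n) mulrC.
    by rewrite ler_wpM2l ?(ltW (tau0 n)) // ler_nat.
  have := grid_approx _ _ _ _ hX _ kn; have := hX t0; have := u_max _ kT.
  rewrite -/(X n k) -/(X n _) !ler_norml => h1 /andP[h2 h3] /andP[h4 h5] h6.
  by apply/andP; split; lra.
exists u, y, (u t0); split => //.
- exact: limit_primitive dXB Xu fX.
- exact: limit_primitive dYB Yy fY.
- split; apply/eqP; rewrite -subr_eq0 -normr_le0.
    suff key (e : R) : 0 < e -> `|u T - u 0| <= 0 + e by exact/ler_addgt0Pr.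
    move=> e0; have e3 : 0 < e / 3 by rewrite divr_gt0.
    have [n [/= hX ht]] := filter_ex (filterI (Xu _ e3) (small_step T Foo e3)).
    have [_ _ hc _] := cpP n; have := hX T; have := hX 0; rewrite idx0 idxT.
    rewrite -/(X n n.+1) in hc; rewrite (_ : X n 0 = (cp n).1) // add0r.
    move: (lt_trans hc ht); rewrite ltr_norml !ler_norml.
    by move=> /andP[? ?] /andP[? ?] /andP[? ?]; apply/andP; split; lra.
  rewrite opprK.
  suff key (e : R) : 0 < e -> `|y T - y 0 + phi (u t0)| <= 0 + e by exact/ler_addgt0Pr.
  move=> e0; have e4 : 0 < e / 4 by rewrite divr_gt0.
  have [d d0 phid] := phiu e4; have d2 : 0 < d / 2 by rewrite divr_gt0.
  have [n [[/= hX hY] ht]] := filter_ex (filterI (filterI (Xu _ d2) (Yy _ e4))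
    (small_step T Foo e4)).
  have [_ _ _ hc] := cpP n; have := hY T; have := hY 0; rewrite idx0 idxT.
  rewrite -/(Y n n.+1) in hc; rewrite (_ : Y n 0 = (cp n).2) // add0r.
  have /phid : `|euler_max H g (aln n) (tau n) (cp n).1 (cp n).2 n.+1 - u t0| < d.
    by apply: le_lt_trans (max_approx _ _ hX) _; rewrite ltr_pdivrMr // ltr_pMr // ltr1n.
  move: (lt_trans hc ht); rewrite !ltr_norml !ler_norml.
  by move=> /andP[? ?] /andP[? ?] /andP[? ?] /andP[? ?]; apply/andP; split; lra.
- split; last by exists t0 => //; move: t0T; rewrite in_itv.
  by move=> t tT; apply: u_max; rewrite in_itv.
Qed.

End Shooting.

(** * A priori estimates *)

Section StayZero.
Variables (R : realType) (w y : R -> R) (s T L C : R).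
Hypotheses (L0 : 0 <= L) (C0 : 0 <= C) (wc : continuous w).
Hypothesis w0 : forall t, s <= t <= T -> 0 <= w t.
Hypotheses (ws : w s = 0) (ys : y s <= 0).
(** [dw] and [dy] are integrated forms of [w' <= y + L w] and [y' <= C w], as [y] need not be
    differentiable everywhere. *)
Hypothesis dw : forall t1 t2 k : R, s <= t1 -> t1 <= t2 -> t2 <= T ->
  (forall x, t1 < x < t2 -> y x + L * w x <= k) -> w t2 - w t1 <= k * (t2 - t1).
Hypothesis dy : forall t W : R, s <= t <= T ->
  (forall x, s < x < t -> w x <= W) -> y t - y s <= C * W * (t - s).

(* On an interval of length [d] the bounds give [max w <= max w / 2]. *)
Lemma stay_zero t : s <= t <= T -> w t = 0.
Proof.
move=> stT; have sT : s <= T by case/andP: stT => h; exact: le_trans h.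
set K := C * (T - s) + L + 1.
have K0 : 0 < K by rewrite ltr_wpDl // addr_ge0 // mulr_ge0 // subr_ge0.
pose d := (K *+ 2)^-1; have d0 : 0 < d by rewrite invr_gt0 pmulrn_lgt0.
suff iter n : forall x, s <= x <= T -> x <= s + n%:R * d -> w x = 0.
  apply: (iter (Num.truncn ((t - s) / d)).+1) => //.
  by rewrite -lerBlDl -ler_pdivrMr // ltW // truncnS_gt.
elim: n => [|n IH] x /andP[sx xT].
  by rewrite mul0r addr0 => xs; rewrite (_ : x = s) //; apply/le_anti; rewrite xs.
set s1 := s + n%:R * d => xs.
have [/IH ->//|s1x] := leP x s1; first by rewrite sx xT.
have s1s : s <= s1 by rewrite lerDl mulr_ge0 // ltW.
have [z /[!in_itv]/= /andP[s1z zx] zmax] :=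
  EVT_max (ltW s1x) (continuous_subspaceT wc).
have zT : z <= T by exact: le_trans xT.
have sz : s <= z by exact: le_trans s1z.
have W0 : 0 <= w z by rewrite w0 // sz.
(* Since [w] vanishes up to [s1], its maximum on the new stage bounds it from [s] on, as [dy]
   requires. *)
have wW v : s <= v <= x -> w v <= w z.
  move=> /andP[sv vx]; have [vs1|s1v] := leP v s1.
    by rewrite (IH v) // sv (le_trans vx).
  by apply: zmax; rewrite in_itv /= vx ltW.
have : w z - w s1 <= (C * (T - s) + L) * w z * (z - s1).
  apply: dw => // v /andP[s1v vz].
  have sv : s <= v by rewrite (le_trans s1s) // ltW.
  have vx : v <= x by apply: le_trans zx; exact: ltW.
  have h1 : y v - y s <= C * w z * (v - s).
    apply: dy; first by rewrite sv (le_trans vx).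
    by move=> v' /andP[sv' v'v]; apply: wW; rewrite !ltW //; apply: lt_le_trans vx.
  have h2 : C * w z * (v - s) <= C * w z * (T - s).
    by rewrite ler_wpM2l ?mulr_ge0 // lerD2r (le_trans vx).
  have h3 : L * w v <= L * w z by rewrite ler_wpM2l // wW // sv vx.
  have -> : (C * (T - s) + L) * w z = C * w z * (T - s) + L * w z by ring.
  apply: lerD => //; apply: le_trans h2; apply: le_trans h1.
  by rewrite lerDl oppr_ge0.
have -> : w s1 = 0 by apply: IH; [rewrite s1s (le_trans s1z)|exact: lexx].
rewrite subr0 => h.
have zd : z - s1 <= d.
  by rewrite lerBlDr (le_trans zx) // (le_trans xs) // /s1 -natr1 mulrDl mul1r addrA [leLHS]addrC.
have Kd : (C * (T - s) + L) * d <= 2^-1.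
  rewrite /d -mulr_natl invfM mulrCA ger_pMr ?invr_gt0 //.
  by rewrite ler_pdivrMr // mul1r lerDl.
have : (C * (T - s) + L) * w z * (z - s1) <= w z * 2^-1.
  rewrite mulrAC mulrC ler_wpM2l //; apply: le_trans Kd.
  by rewrite ler_wpM2l // addr_ge0 // mulr_ge0 // subr_ge0.
move=> h'; have wz : w z <= 0 by lra.
by apply/le_anti; rewrite w0 ?sx // andbT (le_trans _ wz) // wW // sx lexx.
Qed.

End StayZero.

Section Gronwall.
Variable R : realType.

(* [(v^2 + E^2) exp (- (2 L + 1) x)] is nonincreasing. *)
Lemma gronwall (v dv : R -> R) (s t L E : R) : 0 <= L -> 0 <= E -> s <= t ->
  continuous v -> (forall x, s < x < t -> is_derive x (1 : R) v (dv x)) ->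
  (forall x, s < x < t -> `|dv x| <= E + L * `|v x|) ->
  `|v t| <= expR ((2 * L + 1) * (t - s)) * (`|v s| + E).
Proof.
move=> L0 E0 st vc vd dvE; set k := 2 * L + 1.
have k0 : 0 <= k by rewrite addr_ge0 // mulr_ge0.
pose phi x := (v x * v x + E * E) * expR (- k * x).
pose dphi x := (2 * v x * dv x - k * (v x * v x + E * E)) * expR (- k * x).
have phid x : x \in `]s, t[ -> is_derive x 1 phi (dphi x).
  rewrite in_itv /= => /vd ?; rewrite /phi /dphi.
  apply: is_derive_eq; rewrite /GRing.scale /=; ring.
have phic : continuous phi.
  move=> x; apply: cvgM; first by apply: cvgD; [apply: cvgM; exact: vc|exact: cvg_cst].
  apply: continuous_comp; last exact: continuous_expR.
  by apply: cvgM; [exact: cvg_cst|].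
have : phi t <= phi s.
  move: st; rewrite le_eqVlt => /orP[/eqP->//|st].
  have [c] := MVT st phid (continuous_subspaceT phic).
  rewrite in_itv /= => cst h; rewrite -subr_le0 h pmulr_lle0 ?subr_gt0 //.
  rewrite pmulr_lle0 ?expR_gt0 // subr_le0.
  have h1 : v c * dv c <= `|v c| * (E + L * `|v c|).
    by apply: le_trans (ler_norm _) _; rewrite normrM ler_wpM2l // dvE.
  have h2 : v c * v c = `|v c| * `|v c| by rewrite -normrM ger0_norm // -expr2 sqr_ge0.
  have h3 := mulr_ge0 L0 (mulr_ge0 E0 E0).
  (* This square absorbs the cross term [2 E |v c|]. *)
  have h4 : 0 <= (`|v c| - E) * (`|v c| - E) by rewrite -expr2 sqr_ge0.
  rewrite h2 /k -mulrA; apply: (@le_trans _ _ (2 * (`|v c| * (E + L * `|v c|)))).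
    by rewrite ler_wpM2l.
  rewrite -subr_ge0; apply: (@le_trans _ _
    ((`|v c| - E) * (`|v c| - E) + 2 * (L * (E * E)))).
    by rewrite addr_ge0 // mulr_ge0.
  by rewrite le_eqVlt; apply/orP; left; apply/eqP; ring.
rewrite /phi mulNr mulNr -ler_pdivlMr ?expR_gt0 // -mulrA -expRN opprK -expRD.
rewrite [- (k * s) + _]addrC -mulrBr; set X := expR _ => h.
have X1 : 1 <= X by rewrite -expR0 ler_expR mulr_ge0 // subr_ge0.
have B0 : 0 <= `|v s| + E by rewrite addr_ge0.
rewrite -ler_sqr ?nnegrE ?mulr_ge0 // ?(le_trans ler01) //.
apply: (@le_trans _ _ (v t * v t + E * E)).
  by rewrite real_normK ?num_real // expr2 lerDl mulr_ge0.
apply: le_trans h _; rewrite exprMn mulrC; apply: ler_pM => //.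
- by rewrite (le_trans ler01).
- by rewrite -!expr2 addr_ge0 ?sqr_ge0.
- by rewrite expr2 ler_peMl // (le_trans ler01).
- rewrite sqrrD -expr2 -real_normK ?num_real // -addrA lerD2l -expr2 lerDr.
  by rewrite mulrn_wge0 // mulr_ge0.
Qed.

End Gronwall.

(** * Maximum principles for the planar system *)

Section System.
Variables (R : realType) (T : R) (al H g u y : R -> R) (A L : R).
Hypotheses (T0 : 0 < T) (L0 : 0 <= L) (A0 : 0 <= A).
Hypotheses (uc : continuous u) (yc : continuous y).
Hypothesis HL : forall r s, `|H r - H s| <= L * `|r - s|.
Hypothesis alA : forall t, `|al t| <= A.
Hypothesis g_ge0 : forall s, 0 <= g s.
Hypothesis du : primitive (fun t => y t - H (u t)) u 0 T.
Hypothesis dy : primitive (fun t => - (al t * g (u t))) y 0 T.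

Let velocity_cont t : {for t, continuous (fun t => y t - H (u t))}.
Proof.
have Hc := lipschitz_continuous HL.
by apply: cvgB; [exact: yc|apply: continuous_comp; [exact: uc|exact: Hc]].
Qed.

(** Only times before [t] are compared, so [t = T] is allowed, while [t = 0], where [y] may have
    jumped, is excluded. *)
Lemma velocity_at_max t : 0 < t <= T -> (forall s, 0 <= s <= T -> u s <= u t) ->
  H (u t) <= y t.
Proof.
move=> tT umax; rewrite leNgt; apply/negP => yH.
have nc : {for t, continuous (fun t => - (y t - H (u t)))}.
  by apply: cvgN; exact: velocity_cont.
have [|s /andP[s0 st]] := primitive_above_left (primitiveN du) nc tT.
  by rewrite oppr_gt0 subr_lt0.
rewrite ltrN2 => us; have : u s <= u t.
  by apply: umax; rewrite s0 /=; case/andP: tT => _; apply: le_trans; exact: ltW.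
by rewrite leNgt us.
Qed.

Lemma velocity_at_min t : 0 < t <= T -> (forall s, 0 <= s <= T -> u t <= u s) ->
  y t <= H (u t).
Proof.
move=> tT umin; rewrite leNgt; apply/negP => yH.
have [|s /andP[s0 st]] := primitive_above_left du (@velocity_cont t) tT.
  by rewrite subr_gt0.
move=> us; have : u t <= u s.
  by apply: umin; rewrite s0 /=; case/andP: tT => _; apply: le_trans; exact: ltW.
by rewrite leNgt us.
Qed.

(** At a minimum [u x0 <= 0] one has [y x0 <= 0], since [H] vanishes there, and [u - u x0] then
    stays zero up to [T]. As [u T = u 0] and [y 0 <= y T], the argument restarts at [0] and makes
    [u] constant, against its positive value: the sign of the jump is what lets it cross the base
    point. *)
Lemma positivity (K : R) : 0 <= K -> (forall s, g s <= K * Num.max 0 s) ->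
  (forall s, s <= 0 -> H s = 0) ->
  u T = u 0 -> y 0 <= y T -> (exists2 t, 0 <= t <= T & 0 < u t) ->
  forall t, 0 <= t <= T -> 0 < u t.
Proof.
move=> K0 gK H0 uT yT [t0 t0T ut0] t tT; rewrite ltNge; apply/negP => ut.
have [x0 /[!in_itv]/= x0T umin] := EVT_min (ltW T0) (continuous_subspaceT uc).
have m0 : u x0 <= 0 by apply: le_trans ut; apply: umin; rewrite in_itv.
have {}umin s : 0 <= s <= T -> u x0 <= u s by move=> sT; apply: umin; rewrite in_itv.
have posle s : 0 <= s <= T -> Num.max 0 (u s) <= u s - u x0.
  by move=> /umin us; rewrite ge_max subr_ge0 us lerDl oppr_ge0.
have wc : continuous (fun s => u s - u x0).
  by move=> s; apply: cvgB; [exact: uc|exact: cvg_cst].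
have HLm s : `|H (u s)| <= L * Num.max 0 (u s).
  have [us|us] := leP 0 (u s); last by rewrite H0 ?normr0 ?mulr0 // ltW.
  by have := HL (u s) 0; rewrite (H0 0) // !subr0 (ger0_norm us).
(* [H (u)] and [g (u)] are bounded by multiples of [max 0 u], hence of [u - u x0], because
   [u x0 <= 0]. *)
have spread s : 0 <= s -> u s = u x0 -> y s <= 0 ->
    forall v, s <= v <= T -> u v = u x0.
  move=> s0 us ys v svT; apply/eqP; rewrite -subr_eq0; apply/eqP.
  apply: (@stay_zero R (fun s => u s - u x0) y s T L (A * K)) => //.
  - by rewrite mulr_ge0.
  - by move=> r /andP[sr rT]; rewrite subr_ge0 umin // rT (le_trans s0).
  - by rewrite us subrr.
  - move=> t1 t2 k st1 t12 t2T hk; rewrite opprB addrA subrK.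
    apply: (primitive_le du) => //; first exact: le_trans st1.
    move=> r /andP[t1r rt2]; apply: le_trans (hk r _); last by rewrite t1r.
    have rT : 0 <= r <= T.
      by rewrite (le_trans s0 (le_trans st1 (ltW t1r))) (le_trans (ltW rt2)).
    rewrite lerD2l; apply: le_trans (ler_norm _) _; rewrite normrN.
    by apply: le_trans (HLm r) _; rewrite ler_wpM2l // posle.
  - move=> r W /andP[sr rT] hW; apply: (primitive_le dy) => // v' /andP[sv vr].
    have v'T : 0 <= v' <= T.
      by rewrite (le_trans s0 (ltW sv)) (le_trans (ltW vr)).
    apply: le_trans (ler_norm _) _; rewrite normrN normrM -mulrA.
    apply: ler_pM => //; rewrite ger0_norm //; apply: le_trans (gK _) _.
    rewrite ler_wpM2l //; apply: le_trans (posle _ v'T) _; apply: hW.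
    by rewrite sv vr.
have uTm : u T = u x0.
  have : 0 <= x0 by case/andP: x0T.
  rewrite le_eqVlt => /orP[/eqP h|x00]; first by rewrite uT h.
  have yx0 : y x0 <= 0.
    by rewrite -(H0 (u x0)) // velocity_at_min // x00; case/andP: x0T.
  by apply: (spread x0 _ erefl yx0); rewrite ?(ltW x00) // lexx andbT; case/andP: x0T.
have yT0 : y T <= 0.
  rewrite -(H0 (u T)) ?uTm //; rewrite -uTm; apply: velocity_at_min.
    by rewrite T0 lexx.
  by move=> s sT; rewrite uTm umin.
have := spread 0 (lexx 0) (etrans (esym uT) uTm) (le_trans yT yT0) t0 t0T.
by move=> h; move: ut0; rewrite h ltNge m0.
Qed.

(** Where the weight is nonpositive [y] is nondecreasing, so [y >= H (u t1)] after [t1], and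
    [w = u t1 - u] satisfies [w' <= L w] with [w t1 = 0]. *)
Lemma max_propagation t1 t2 : 0 < t1 -> t1 <= t2 -> t2 <= T ->
  (forall s, 0 <= s <= T -> u s <= u t1) ->
  (forall s, t1 < s < t2 -> al s <= 0) -> u t2 = u t1.
Proof.
move=> t10 t12 t2T umax al0.
have Hy : H (u t1) <= y t1 by apply: velocity_at_max => //; rewrite t10 (le_trans t12).
apply/esym/eqP; rewrite -subr_eq0; apply/eqP.
apply: (@stay_zero R (fun s => u t1 - u s) (fun=> 0) t1 t2 L 0) => //.
- by move=> s; apply: cvgB; [exact: cvg_cst|exact: uc].
- by move=> s /andP[t1s st2]; rewrite subr_ge0 umax // (le_trans st2) // (le_trans (ltW t10)).
- by rewrite subrr.
- move=> s s' k t1s ss' s't2 hk.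
  have -> : u t1 - u s' - (u t1 - u s) = - u s' - - u s by ring.
  apply: (primitive_le (primitiveN du)) => //.
  + by rewrite (le_trans (ltW t10)).
  + exact: le_trans t2T.
  move=> r /andP[sr rs']; apply: le_trans (hk r _); last by rewrite sr.
  have t1r : t1 <= r by rewrite (le_trans t1s) // ltW.
  have rt2 : r <= t2 by rewrite (le_trans (ltW rs')).
  have yr : y t1 <= y r.
    rewrite -subr_ge0 -(mul0r (r - t1)); apply: (primitive_ge dy) => //.
    - exact: ltW.
    - exact: le_trans t2T.
    move=> q /andP[t1q qr]; rewrite oppr_ge0 mulr_le0_ge0 // al0 // t1q.
    exact: lt_le_trans rt2.
  have ur : u r <= u t1 by apply: umax; rewrite (le_trans (ltW t10)) ?(le_trans rt2).
  have := HL (u r) (u t1); rewrite (distrC (u r)) (ger0_norm (_ : 0 <= u t1 - u r)) ?subr_ge0 //.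
  move=> h; have := le_trans (ler_norm _) h; rewrite add0r; lra.
- by move=> r W rr hW; rewrite subrr !mul0r.
- by rewrite t12 lexx.
Qed.

End System.

Section Antiderivative.
Variable R : realType.

(** Applied with [a = -1], it gives two-sided derivatives on the closed half line, [0] included. *)
Lemma continuous_antiderivative (f : R -> R) (a : R) : continuous f ->
  exists F : R -> R, forall x, a < x -> is_derive x (1 : R) F (f x).
Proof.
move=> fc; exists (fun x => \int[lebesgue_measure]_(t in [set` `[a, x]]) f t) => x ax.
have x1 : x < x + 1 by rewrite ltrDl.
have fi : lebesgue_measure.-integrable `[a, x + 1] (EFin \o f).
  apply: continuous_compact_integrable; first exact: segment_compact.
  exact: continuous_subspaceT.
have [dF F'] := continuous_FTC1_closed x1 fi ax (fc x).
by rewrite -F' derive1E; exact/derivableP.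
Qed.

Lemma is_derive_lipschitz (F f : R -> R) (a b L s t : R) :
  (forall x, a <= x <= b -> is_derive x (1 : R) F (f x)) ->
  (forall x, a <= x <= b -> `|f x| <= L) -> a <= s <= b -> a <= t <= b ->
  `|F s - F t| <= L * `|s - t|.
Proof.
wlog st : s t / s <= t.
  move=> H; have [st|/ltW ts] := leP s t; first exact: H.
  by rewrite distrC (distrC s) => *; exact: H.
move=> dF fL /andP[as_ sb] /andP[at_ tb].
have inab x : s <= x <= t -> a <= x <= b.
  by move=> /andP[sx xt]; rewrite (le_trans as_) // (le_trans xt).
have [c cst e] : exists2 c, c \in `[s, t] & F t - F s = f c * (t - s).
  apply: MVT_segment => // [x|]; first by rewrite in_itv /= => /andP[sx xt];
    apply: dF; apply: inab; rewrite !ltW.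
  by apply: derivable_within_continuous => x; rewrite in_itv /= => /inab /dF [].
rewrite distrC e normrM (distrC s t) ler_wpM2r // fL // inab //.
Qed.

End Antiderivative.

(** * Large maxima where the weight is nonnegative *)

Section ConcaveBump.
Variable R : realType.

(* [u' = - q / E] and [q' = E F] are encoded by mean value equations, a form that
   is stable under the reflection [x |-> - x]. *)
Lemma concave_bump (u q E F : R -> R) (x1 s t r T M c k : R) :
  1 <= c -> (forall x, x1 <= x <= r -> c^-1 <= E x <= c) ->
  x1 <= s -> s < t -> t < r -> r - x1 <= T -> 0 <= k ->
  0 <= q x1 -> u x1 = M -> 0 <= u r ->
  (forall t1 t2 : R, x1 <= t1 -> t1 < t2 -> t2 <= r ->
     exists2 z, t1 < z < t2 & u t2 - u t1 = - (q z / E z) * (t2 - t1)) ->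
  (forall t1 t2 : R, x1 <= t1 -> t1 < t2 -> t2 <= r ->
     exists2 z, t1 < z < t2 & q t2 - q t1 = E z * F z * (t2 - t1)) ->
  (forall x, x1 < x < r -> 0 <= F x) ->
  (forall x, s < x < t -> M <= (1 + T * c ^+ 2 / (r - t)) * u x -> k <= F x) ->
  k * (t - s) * (r - t) <= c ^+ 2 * M.
Proof.
move=> c1 Ec x1s st tr rT k0 q0 ux1 ur du dq F0 Fk.
have c0 : 0 < c by apply: lt_le_trans c1.
have E0 x : x1 <= x <= r -> 0 < E x.
  by move=> /Ec /andP[h _]; apply: lt_le_trans h; rewrite invr_gt0.
have x1t : x1 < t by apply: le_lt_trans st.
have sr : s < r by exact: lt_trans tr.
have rt0 : 0 < r - t by rewrite subr_gt0.
have qmono v w : x1 <= v -> v <= w -> w <= r -> q v <= q w.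
  move=> x1v; rewrite le_eqVlt => /orP[/eqP->//|vw wr].
  have [z /andP[vz zw] e] := dq _ _ x1v vw wr.
  have x1z : x1 < z by exact: le_lt_trans vz.
  have zr : z < r by exact: lt_le_trans wr.
  rewrite -subr_ge0 e mulr_ge0 ?subr_ge0 ?(ltW vw) // mulr_ge0 //.
    by rewrite ltW // E0 // !ltW.
  by rewrite F0 // x1z.
have qpos v : x1 <= v -> v <= r -> 0 <= q v.
  by move=> x1v vr; apply: le_trans q0 _; exact: qmono.
(* From [v] to [r] the function [u] decreases at rate at least [q v / c] and ends nonnegative. *)
have qu v : x1 <= v -> v <= t -> q v * (r - t) <= c * u v.
  move=> x1v vt; have vr : v < r by exact: le_lt_trans tr.
  have [z /andP[vz zr] e] := du _ _ x1v vr (lexx r).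
  have x1z : x1 <= z by rewrite (le_trans x1v) // ltW.
  have zE : x1 <= z <= r by rewrite x1z ltW.
  have h1 : q v / c <= q z / E z.
    apply: ler_pM; [exact: qpos x1v (ltW vr)|by rewrite invr_ge0 ltW| |].
      by apply: qmono => //; exact: ltW.
    by rewrite lef_pV2 ?posrE ?E0 //; case/andP: (Ec _ zE).
  have h2 : q v / c * (r - t) <= q z / E z * (r - v).
    apply: ler_pM => //; [|exact: ltW|by rewrite lerD2l lerN2].
    by rewrite divr_ge0 ?qpos // ltW.
  have h3 : q z / E z * (r - v) <= u v by move: e; rewrite mulNr; lra.
  by have := le_trans h2 h3; rewrite mulrAC ler_pdivrMr // (mulrC c).
(* Conversely, the loss from [M] up to [v] is at most [c * q v * T], which [qu] bounds by a multiple
   of [u v]: so [u] stays comparable with [M] up to [t]. *)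
have Mu v : x1 <= v -> v <= t -> M <= (1 + T * c ^+ 2 / (r - t)) * u v.
  move=> x1v vt; have vr : v <= r by apply: le_trans (ltW tr).
  have qv0 := qpos v x1v vr.
  have MuT : M - u v <= c * q v * T.
    move: x1v; rewrite le_eqVlt => /orP[/eqP e|x1v].
      rewrite -e ux1 subrr !mulr_ge0 ?(ltW c0) //.
      by apply: le_trans rT; rewrite subr_ge0 ltW // (lt_trans x1t).
    have [z /andP[x1z zv] e] := du _ _ (lexx x1) x1v vr.
    have zr : z <= r by rewrite (le_trans (ltW zv)).
    have zE : x1 <= z <= r by rewrite (ltW x1z).
    have -> : M - u v = q z / E z * (v - x1) by rewrite -ux1; move: e; rewrite mulNr; lra.
    apply: ler_pM; rewrite ?subr_ge0 ?(ltW x1v) //.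
    - by rewrite divr_ge0 ?qpos ?(ltW x1z) // ltW // E0.
    - rewrite mulrC; apply: ler_pM.
      + by rewrite invr_ge0 ltW // E0.
      + by apply: qpos zr; exact: ltW.
      + by rewrite invf_ple ?posrE ?E0 //; case/andP: (Ec _ zE).
      + by apply: qmono => //; exact: ltW.
    - by apply: le_trans rT; rewrite lerD2r.
  have := qu v x1v vt; rewrite -ler_pdivlMr // => h.
  rewrite mulrDl mul1r -lerBlDl; apply: le_trans MuT _.
  have T0 : 0 <= T by apply: le_trans rT; rewrite subr_ge0 ltW // (lt_trans x1t).
  have -> : T * c ^+ 2 / (r - t) * u v = c * (c * u v / (r - t)) * T.
    by rewrite expr2; ring.
  by rewrite ler_wpM2r // ler_wpM2l // ltW.
have [z /andP[sz zt] e] := dq _ _ x1s st (ltW tr).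
have x1z : x1 <= z by rewrite (le_trans x1s) // ltW.
have zE : x1 <= z <= r by rewrite x1z (le_trans (ltW zt)) // ltW.
have kF : k <= F z by apply: Fk; [rewrite sz|apply: Mu => //; exact: ltW].
(* The growth of [q] on [(s, t)] is bounded below by [k]; [qu] at [t] bounds [q t] above by a
   multiple of [u t <= M]. *)
have h1 : c^-1 * k * (t - s) <= q t.
  apply: (@le_trans _ _ (q t - q s)); last first.
    by rewrite lerBlDr lerDl qpos // ltW.
  rewrite e ler_wpM2r ?subr_ge0 ?(ltW st) //.
  by apply: ler_pM; rewrite ?invr_ge0 ?(ltW c0) //; case/andP: (Ec _ zE).
have utM : u t <= M.
  have [z' /andP[x1z' z't] e'] := du _ _ (lexx x1) x1t (ltW tr).
  rewrite -ux1 -subr_le0 e' mulNr oppr_le0 mulr_ge0 ?subr_ge0 ?(ltW x1t) //.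
  have z'r : z' <= r by rewrite (le_trans (ltW z't)) // ltW.
  by rewrite divr_ge0 ?qpos ?(ltW x1z') // ltW // E0 // (ltW x1z').
have h2 := qu t (ltW x1t) (lexx t).
have h3 : c^-1 * k * (t - s) * (r - t) <= c * M.
  apply: (@le_trans _ _ (q t * (r - t))); first by rewrite ler_wpM2r // ltW.
  by apply: le_trans h2 _; rewrite ler_wpM2l // ltW.
have -> : k * (t - s) * (r - t) = c * (c^-1 * k * (t - s) * (r - t)).
  by rewrite !mulrA divff ?gt_eqF // mul1r.
by rewrite expr2 -(mulrA c c M) ler_wpM2l // ltW.
Qed.

End ConcaveBump.

Section LargeMaximum.
Variables (R : realType) (T L : R) (h H : R -> R).
Hypotheses (T0 : 0 < T) (L0 : 0 <= L).
Hypotheses (hc : continuous h) (hL : forall s : R, `|h s| <= L).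
Hypothesis dH : forall s : R, 0 <= s -> is_derive s (1 : R) H (h s).

(** The threshold is uniform in the solution. When the maximum point is on one side of the midpoint
    [m] of [[s, t]], the other half of [[s, t]] feeds [concave_bump]. The weight is prescribed only
    inside [(l, r)], because the rotated weight is not continuous on the whole period. *)
Lemma no_large_max (a0 l s t r : R) (g : R -> R) :
  0 < a0 -> 0 <= l -> l < s -> s < t -> t < r -> r <= T ->
  (forall v : R, 0 <= v -> 0 <= g v) ->
  (forall K : R, exists2 s0 : R, 0 < s0 & forall v : R, s0 <= v -> K * v <= g v) ->
  exists2 M0 : R, 0 < M0 & forall (M x1 : R) (al ac gM u y : R -> R),
    M0 <= M -> continuous ac -> continuous gM -> continuous u -> continuous y ->
    (forall v : R, 0 <= v <= M -> gM v = g v) ->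
    (forall x : R, l < x < r -> al x = ac x /\ 0 <= ac x) ->
    (forall x : R, s < x < t -> a0 <= ac x) ->
    primitive (fun v => y v - H (u v)) u 0 T ->
    primitive (fun v => - (al v * gM (u v))) y 0 T ->
    (forall v : R, 0 <= v <= T -> 0 < u v <= M) -> l <= x1 <= r -> u x1 = M -> False.
Proof.
move=> a00 l0 ls st tr rT g_ge0 gsup.
set c := expR (L * T); have c1 : 1 <= c by rewrite -expR0 ler_expR mulr_ge0 // ltW.
pose m := (s + t) / 2.
have sm : s < m by rewrite /m; lra.
have mt : m < t by rewrite /m; lra.
(* [k1], [th1] are the factors of [concave_bump] on [(m, t)] towards [r], and [k2], [th2] those on
   [(s, m)] towards [l]; [K] is larger than both of the resulting bounds. *)
pose k1 := (t - m) * (r - t); pose th1 := 1 + T * c ^+ 2 / (r - t).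
pose k2 := (m - s) * (s - l); pose th2 := 1 + T * c ^+ 2 / (s - l).
have k10 : 0 < k1 by rewrite mulr_gt0 ?subr_gt0.
have k20 : 0 < k2 by rewrite mulr_gt0 ?subr_gt0.
have c20 : 0 < c ^+ 2 by rewrite exprn_gt0 // expR_gt0.
have th10 : 0 < th1.
  by rewrite ltr_pwDl // divr_ge0 ?(mulr_ge0 (ltW T0) (ltW c20)) ?subr_ge0 ?(ltW tr).
have th20 : 0 < th2.
  by rewrite ltr_pwDl // divr_ge0 ?(mulr_ge0 (ltW T0) (ltW c20)) ?subr_ge0 ?(ltW ls).
have Q1 := ltW (divr_gt0 (mulr_gt0 c20 th10) (mulr_gt0 a00 k10)).
have Q2 := ltW (divr_gt0 (mulr_gt0 c20 th20) (mulr_gt0 a00 k20)).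
pose K := (c ^+ 2 * th1 / (a0 * k1) + c ^+ 2 * th2 / (a0 * k2)) + 1.
have K0 : 0 < K by rewrite ltr_wpDl // addr_ge0.
have [s0 s00 gK] := gsup K.
have s00' : 0 < s0 by exact: s00.
exists (s0 * (th1 + th2)); first exact: mulr_gt0 s00' (addr_gt0 th10 th20).
move=> M x1 al ac gM u y M0M acc gMc uc yc gMg alac aca0 du dy u_itv /andP[lx1 x1r] ux1.
have M0 : 0 < M by apply: lt_le_trans M0M; exact: mulr_gt0 s00' (addr_gt0 th10 th20).
have lr : l < r by apply: lt_trans ls (lt_trans st tr).
have inT x : l <= x <= r -> 0 <= x <= T.
  by move=> /andP[lx xr]; rewrite (le_trans l0) // (le_trans xr).
have umax x : 0 <= x <= T -> u x <= u x1 by rewrite ux1 => /u_itv /andP[].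
have HL v w : 0 <= v -> 0 <= w -> `|H v - H w| <= L * `|v - w|.
  move=> v0 w0; apply: (@is_derive_lipschitz _ H h 0 (v + w)) => //.
  - by move=> x /andP[x0 _]; exact: dH.
  - by rewrite v0 lerDl.
  - by rewrite w0 lerDr.
have Hu_cont x : 0 <= x <= T -> {for x, continuous (fun v => H (u v))}.
  move=> /u_itv /andP[ux0 _]; apply: continuous_comp; first exact: uc.
  by have [dHx _] := dH (ltW ux0); apply/differentiable_continuous/derivable1_diffP.
have du_cont x : 0 <= x <= T -> {for x, continuous (fun v => y v - H (u v))}.
  by move=> xT; apply: cvgB; [exact: yc|exact: Hu_cont].
(* [x1] may be an end of [[l, r]]: each sign of the velocity is claimed only when the corresponding
   side is available. *)
have Hx1_r : x1 < r -> y x1 <= H (u x1).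
  move=> x1r'; rewrite leNgt; apply/negP => yH.
  have x1T : 0 <= x1 < T by rewrite (le_trans l0 lx1) (lt_le_trans x1r').
  have x1T' : 0 <= x1 <= T by apply: inT; rewrite lx1.
  have [|z /andP[x1z zT]] := primitive_above_right du (du_cont _ x1T') x1T.
    by rewrite subr_gt0.
  rewrite ltNge umax // zT andbT; apply: le_trans (ltW x1z); exact: le_trans lx1.
have Hx1_l : l < x1 -> H (u x1) <= y x1.
  move=> lx1'; rewrite leNgt; apply/negP => yH.
  have x1T : 0 < x1 <= T by rewrite (le_lt_trans l0 lx1') (le_trans x1r).
  have x1T' : 0 <= x1 <= T by apply: inT; rewrite lx1.
  have nc : {for x1, continuous (fun v => - (y v - H (u v)))}.
    by apply: cvgN; exact: du_cont.
  have [|z /andP[z0 zx1]] := primitive_above_left (primitiveN du) nc x1T.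
    by rewrite oppr_gt0 subr_lt0.
  rewrite ltrN2 ltNge umax // z0 (le_trans (ltW zx1)) //; exact: le_trans rT.
have [B dB] := @continuous_antiderivative R (fun x => h (u x)) (-1)
  (fun x => continuous_comp (@uc x) (@hc (u x))).
pose E x := expR (B x - B 0).
have Ec x : 0 <= x <= T -> c^-1 <= E x <= c.
  move=> /andP[x0 xT]; have : `|B x - B 0| <= L * T.
    apply: (@le_trans _ _ (L * `|x - 0|)).
      apply: (@is_derive_lipschitz _ B (fun x => h (u x)) 0 T) => //.
      - by move=> z /andP[z0 _]; apply: dB; apply: lt_le_trans z0; rewrite oppr_lt0.
      - by rewrite x0.
      - by rewrite lexx ltW.
    by rewrite subr0 ger0_norm // ler_wpM2l.
  by rewrite ler_norml /E /c -expRN !ler_expR.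
have E0 x : 0 < E x by exact: expR_gt0.
(* [E] is an integrating factor: [q = - u' E] satisfies [q' = E F]. *)
pose q x := (H (u x) - y x) * E x.
pose F x := ac x * gM (u x).
have ud x : 0 < x < T -> is_derive x (1 : R) u (y x - H (u x)).
  move=> xT; apply: (primitive_is_derive du) => //; apply: du_cont.
  by case/andP: xT => *; rewrite !ltW.
have dyE : primitive (fun v => - F v) y l r.
  apply: (primitive_eq (primitive_sub dy l0 rT)) => // x /alac [-> _] //.
have Fc : continuous F.
  by move=> x; apply: cvgM; [exact: acc|apply: continuous_comp; [exact: uc|exact: gMc]].
have yd x : l < x < r -> is_derive x (1 : R) y (- F x).
  by move=> xlr; apply: (primitive_is_derive dyE) => //; apply: cvgN; exact: Fc.
have inT' x : l < x < r -> 0 < x < T.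
  by move=> /andP[lx xr]; rewrite (le_lt_trans l0) // (lt_le_trans xr).
have qd x : l < x < r -> is_derive x (1 : R) q (E x * F x).
  move=> xlr; have /andP[x0 xT] := inT' _ xlr.
  have ? := ud _ (inT' _ xlr); have ? := yd _ xlr.
  have /andP[ux0 _] : 0 < u x <= M by apply: u_itv; rewrite !ltW.
  have ? := dH (ltW ux0).
  have ? : is_derive x (1 : R) B (h (u x)) by apply: dB; apply: lt_trans x0; rewrite oppr_lt0.
  have ? : is_derive x (1 : R) (H \o u) (h (u x) * (y x - H (u x))).
    apply: is_derive1_comp.
  rewrite /q /E; apply: is_derive_eq; rewrite /GRing.scale /=; ring.
have qc x : l <= x <= r -> {for x, continuous q}.
  move=> /inT xT; apply: cvgM.
    by apply: cvgB; [exact: Hu_cont|exact: yc].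
  apply: continuous_comp; last exact: continuous_expR.
  apply: cvgB; last exact: cvg_cst.
  have [dBx _] : is_derive x (1 : R) B (h (u x)).
    by apply: dB; apply: lt_le_trans (_ : 0 <= x); [rewrite oppr_lt0|case/andP: xT].
  exact/differentiable_continuous/derivable1_diffP.
have dq t1 t2 : l <= t1 -> t1 < t2 -> t2 <= r ->
    exists2 z, t1 < z < t2 & q t2 - q t1 = E z * F z * (t2 - t1).
  move=> lt1 t12 t2r; have [||z zt e] := @MVT R q (fun x => E x * F x) t1 t2 t12.
  - move=> x; rewrite in_itv /= => /andP[t1x xt2]; apply: qd.
    by rewrite (le_lt_trans lt1 t1x) (lt_le_trans xt2).
  - apply: continuous_in_subspaceT => x; rewrite inE /= in_itv /= => /andP[t1x xt2].
    by apply: qc; rewrite (le_trans lt1 t1x) (le_trans xt2).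
  by exists z => //; move: zt; rewrite in_itv.
have duE t1 t2 : l <= t1 -> t1 < t2 -> t2 <= r ->
    exists2 z, t1 < z < t2 & u t2 - u t1 = - (q z / E z) * (t2 - t1).
  move=> lt1 t12 t2r; have [||z zt e] := @MVT R u (fun x => y x - H (u x)) t1 t2 t12.
  - move=> x; rewrite in_itv /= => /andP[t1x xt2]; apply/ud/inT'.
    by rewrite (le_lt_trans lt1 t1x) (lt_le_trans xt2).
  - exact: continuous_subspaceT.
  exists z; first by move: zt; rewrite in_itv.
  by rewrite e /q mulfK ?gt_eqF // opprB.
have Fpos x : l < x < r -> 0 <= F x.
  move=> xlr; have [_ acx] := alac _ xlr; have /andP[x0 xT] := inT' _ xlr.
  have /andP[ux0 uxM] : 0 < u x <= M by apply: u_itv; rewrite !ltW.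
  by rewrite mulr_ge0 // gMg ?g_ge0 ?uxM ?ltW.
(* [u x >= M / th >= s0] puts [u x] in the superlinear range of [g]. *)
have Flarge th x : 0 < th -> th <= th1 + th2 -> s < x < t -> M <= th * u x ->
    a0 * (K * (M / th)) <= F x.
  move=> th0 thle /andP[sx xt] Mu; have lx : l < x by exact: lt_trans sx.
  have xr : x < r by exact: lt_trans tr.
  have xlr : l < x < r by rewrite lx.
  have /andP[x0 xT] := inT' _ xlr.
  have /andP[ux0 uxM] : 0 < u x <= M by apply: u_itv; rewrite !ltW.
  have Mth : M / th <= u x by rewrite ler_pdivrMr // mulrC.
  have sM : s0 <= u x.
    apply: le_trans Mth; rewrite ler_pdivlMr //; apply: le_trans M0M.
    by rewrite ler_wpM2l // ltW.
  apply: ler_pM; rewrite ?(ltW a00) ?aca0 ?sx //.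
    by rewrite mulr_ge0 ?divr_ge0 // ltW.
  rewrite gMg ?uxM ?(ltW ux0) //; apply: le_trans (gK _ sM).
  by rewrite ler_wpM2l // ltW.
have absurd th kk : 0 < th -> 0 < kk -> c ^+ 2 * th / (a0 * kk) < K ->
    a0 * (K * (M / th)) * kk <= c ^+ 2 * M -> False.
  move=> th0 kk0 cK le; move: cK; rewrite ltr_pdivrMr ?mulr_gt0 // ltNge => /negP; apply.
  rewrite -(ler_pM2r (_ : 0 < M / th)) ?divr_gt0 //.
  apply: le_trans (_ : _ <= c ^+ 2 * M) _.
    by apply: le_trans le; rewrite le_eqVlt; apply/orP; left; apply/eqP; ring.
  have -> : c ^+ 2 * th * (M / th) = c ^+ 2 * M by field; rewrite gt_eqF.
  exact: lexx.
have kth th : 0 < th -> 0 <= a0 * (K * (M / th)).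
  by move=> th0; rewrite ltW // mulr_gt0 // mulr_gt0 // divr_gt0.
have [x1m|mx1] := leP x1 m.
  have x1r' : x1 < r by apply: le_lt_trans x1m (lt_trans mt tr).
  apply: (absurd th1 k1) => //.
    by rewrite /K ltr_pwDr // lerDl.
  rewrite /k1 mulrA.
  apply: (@concave_bump R u q E F x1 m t r T M c _ c1) => //.
  - by move=> x /andP[x1x xr]; apply/Ec/inT; rewrite (le_trans lx1).
  - by apply: le_trans rT; rewrite lerBlDr lerDl (le_trans l0).
  - exact: kth.
  - by rewrite mulr_ge0 ?subr_ge0 ?Hx1_r // ltW.
  - have /andP[h1 _] : 0 < u r <= M by apply: u_itv; rewrite (le_trans l0) // ltW.
    exact: ltW.
  - by move=> t1 t2 x1t1; apply: duE; exact: le_trans x1t1.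
  - by move=> t1 t2 x1t1; apply: dq; exact: le_trans x1t1.
  - by move=> x /andP[x1x xr]; apply: Fpos; rewrite xr (le_lt_trans lx1).
  - move=> x /andP[mx xt]; apply: Flarge => //; first by rewrite lerDl ltW.
    by rewrite xt (lt_trans sm).
have lx1' : l < x1 by apply: lt_trans mx1; exact: lt_trans sm.
apply: (absurd th2 k2) => //.
  by rewrite /K ltr_pwDr // lerDr.
rewrite /k2 mulrA.
have -> : s - l = - l - - s by ring.
have -> : m - s = - s - - m by ring.
(* The maximum lies to the right of [m]: time is reflected, which changes the sign of [q]. *)
apply: (@concave_bump R (fun x => u (- x)) (fun x => - q (- x)) (fun x => E (- x))
  (fun x => F (- x)) (- x1) (- m) (- s) (- l) T M c _ c1).
- by move=> x; rewrite lerNl lerNr => /andP[x1x xl]; apply/Ec/inT; rewrite xl (le_trans x1x).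
- by rewrite lerN2 ltW.
- by rewrite ltrN2.
- by rewrite ltrN2.
- by rewrite opprK addrC; apply: le_trans rT; rewrite lerBlDr (le_trans x1r) // lerDl.
- exact: kth.
- by rewrite opprK /q -mulNr opprB mulr_ge0 ?subr_ge0 ?Hx1_l // ltW.
- by rewrite opprK.
- rewrite opprK; have /andP[h1 _] : 0 < u l <= M.
    by apply: u_itv; rewrite l0 (le_trans (ltW lr)).
  exact: ltW.
- move=> t1 t2 x1t1 t12 t2l; have [||| z zt e] := duE (- t2) (- t1).
  + by rewrite lerNr.
  + by rewrite ltrN2.
  + by apply: le_trans x1r; rewrite lerNl.
  exists (- z); first by rewrite ltrNr ltrNl andbC.
  by rewrite -[LHS]opprB e !opprK; ring.
- move=> t1 t2 x1t1 t12 t2l; have [||| z zt e] := dq (- t2) (- t1).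
  + by rewrite lerNr.
  + by rewrite ltrN2.
  + by apply: le_trans x1r; rewrite lerNl.
  exists (- z); first by rewrite ltrNr ltrNl andbC.
  by rewrite !opprK addrC e; ring.
- by move=> x; rewrite ltrNl ltrNr => /andP[h1 h2]; apply: Fpos; rewrite h2 (lt_le_trans h1).
- move=> x; rewrite ltrNl ltrNr => /andP[h1 h2]; rewrite opprK (addrC (- l)) => Mu.
  apply: Flarge => //; first by rewrite lerDr ltW.
  by rewrite h2 (lt_trans h1).
Qed.

End LargeMaximum.

(** * Solutions with a small maximum *)

Section SmallSolutions.
Variables (R : realType) (T L A sigma : R) (g : R -> R).
Hypotheses (T0 : 0 < T) (L0 : 0 <= L) (A0 : 0 <= A) (sigma0 : 0 < sigma).
Hypotheses (g_ge0 : forall s : R, 0 <= s -> 0 <= g s) (g0 : g 0 = 0).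
Hypothesis g_small : forall e : R, 0 < e ->
  exists2 d : R, 0 < d & forall s : R, 0 < s < d -> g s <= e * s.
Hypothesis g_ro : forall e : R, 0 < e -> exists2 d : R, 0 < d &
  forall s w : R, 0 < s < d -> `|w - 1| < d -> `|g (w * s) - g s| <= e * g s.

(** Closeness to the maximum comes from Rolle and Gronwall: [g (u) <= n * M] makes [y] nearly
    constant, so [u] deviates from [M] by a small multiple of [M], which is the scale that regular
    oscillation requires. If [M <= 0] the truncated [g (u)] vanishes and [y] is constant. *)
Lemma small_solutions : exists2 r : R, 0 < r &
  forall (b D M : R) (al H S u y : R -> R), r <= b ->
    (forall t, `|al t| <= A) -> (forall s t, `|H s - H t| <= L * `|s - t|) ->
    0 < D < T -> (forall x, 0 < x < T -> x != D -> {for x, continuous al}) ->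
    continuous S -> primitive al S 0 T -> S T - S 0 = - sigma ->
    continuous (fun s => g (clamp b s)) -> continuous u -> continuous y ->
    primitive (fun t => y t - H (u t)) u 0 T ->
    primitive (fun t => - (al t * g (clamp b (u t)))) y 0 T ->
    u T = u 0 -> (forall t, 0 <= t <= T -> u t <= M) ->
    (exists2 t, 0 <= t <= T & u t = M) -> M <= r -> 0 <= y T - y 0.
Proof.
set K0 := expR ((2 * L + 1) * T).
have k0 : 0 <= 2 * L + 1 by rewrite addr_ge0 // mulr_ge0.
have K00 : 0 <= K0 by exact: expR_ge0.
have AT0 : 0 <= A * T by rewrite mulr_ge0 // ltW.
set C3 := (K0 * (K0 + 1)) *+ 2 * (A * T).
have KK0 : 0 <= K0 * (K0 + 1) by rewrite mulr_ge0 // addr_ge0.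
have C30 : 0 <= C3 by exact: mulr_ge0 (mulrn_wge0 _ KK0) AT0.
(* [e] makes the final error [A * e * T] at most [sigma]; [n] makes the deviation [C3 * n * M] of
   [u] from [M] smaller than [d1 * M]. *)
pose e := sigma / (A * T + 1); have e0 : 0 < e by rewrite divr_gt0 // ltr_wpDl.
have [d d0 ro] := g_ro e0.
pose d1 := Num.min d 1; have d10 : 0 < d1 by rewrite lt_min d0 ltr01.
pose n := d1 / (C3 + 1); have n0 : 0 < n by rewrite divr_gt0 // ltr_wpDl.
have Cn : C3 * n < d1.
  by rewrite /n mulrCA gtr_pMr // ltr_pdivrMr ?ltr_wpDl // mul1r ltrDl.
have [d' d'0 gn] := g_small n0.
pose r := Num.min d d' / 2.
have m0 : 0 < Num.min d d' by rewrite lt_min d0.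
have r0 : 0 < r by rewrite divr_gt0.
have rm : r < Num.min d d' by rewrite ltr_pdivrMr // ltr_pMr // ltr1n.
exists r => // b D M al H S u y rb alA HL /andP[D0 DT] alc Sc dS ST gc uc yc du dy uT uM
  [t0 t0T ut0] Mr.
have b0 : 0 <= b by apply: le_trans rb; exact: ltW.
have [M0|M0] := leP M 0.
  suff : 0 * (T - 0) <= y T - y 0 by rewrite mul0r.
  apply: (primitive_ge dy) => //; first exact: ltW.
  move=> x /andP[x0 xT]; rewrite clamp_le0 ?g0 ?mulr0 ?oppr0 //.
  by apply: le_trans M0; apply: uM; rewrite !ltW.
have Mb : M <= b by exact: le_trans rb.
have [Md Md'] : M < d /\ M < d'.
  by have := le_lt_trans Mr rm; rewrite lt_min => /andP[].
have clamp_le t : 0 <= t <= T -> clamp b (u t) <= M.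
  move=> /uM utM; have [ut|ut] := leP (u t) 0; first by rewrite clamp_le0 // ltW.
  by rewrite clamp_id // (ltW ut) (le_trans utM).
have gM t : 0 <= t <= T -> 0 <= g (clamp b (u t)) <= n * M.
  move=> tT; have /andP[c0 _] := clamp_itv (u t) b0; rewrite g_ge0 //=.
  move: c0 (clamp_le _ tT); rewrite le_eqVlt => /orP[/eqP<-|c0 cM].
    by rewrite g0 mulr_ge0 // ltW.
  apply: le_trans (_ : n * clamp b (u t) <= _); last by rewrite ler_wpM2l // ltW.
  by apply: gn; rewrite c0 (le_lt_trans cM).
set E := A * (n * M) * T.
have nM0 : 0 <= n * M by rewrite mulr_ge0 // ltW.
have E0 : 0 <= E by exact: mulr_ge0 (mulr_ge0 A0 nM0) (ltW T0).
have yE s t : 0 <= s -> s <= t -> t <= T -> `|y t - y s| <= E.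
  move=> s0 st tT; apply: (@le_trans _ _ (A * (n * M) * (t - s))).
    apply: (primitive_bound dy) => // x /andP[sx xt].
    have /andP[h1 h2] : 0 <= g (clamp b (u x)) <= n * M.
      by apply: gM; rewrite (le_trans s0 (ltW sx)) (le_trans (ltW xt)).
    by rewrite normrN normrM; apply: ler_pM => //; rewrite ger0_norm.
  by rewrite /E ler_wpM2l ?(mulr_ge0 A0 nM0) // lerBlDr (le_trans tT) // lerDl.
have Hc := lipschitz_continuous HL.
have ud x : 0 < x < T -> is_derive x (1 : R) u (y x - H (u x)).
  move=> xT; apply: (primitive_is_derive du) => //.
  by apply: cvgB; [exact: yc|apply: continuous_comp; [exact: uc|exact: Hc]].
(* At [xi] the velocity vanishes, so elsewhere it is controlled by the variation [E] of [y] and by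
   [|u - u xi|]. *)
have [xi xiT dxi] : exists2 xi, xi \in `]0, T[ & is_derive xi (1 : R) u 0.
  apply: Rolle => //; last exact: continuous_subspaceT.
  by move=> x; rewrite in_itv /= => /ud [].
have {}xiT : 0 < xi < T by move: xiT; rewrite in_itv.
have yxi : y xi = H (u xi).
  have [_ h1] := ud _ xiT; have [_ h2] := dxi.
  by apply/eqP; rewrite -subr_eq0 -h1 h2.
have /andP[xi0 xiT'] := xiT.
have dvE x : 0 <= x <= T -> `|y x - H (u x)| <= E + L * `|u x - u xi|.
  move=> /andP[x0 xT]; rewrite -(subrKA (y xi)) {2}yxi.
  apply: le_trans (ler_normD _ _) _; apply: lerD; last by rewrite distrC HL.
  by have [h|/ltW h] := leP xi x; [apply: yE => //; exact: ltW|
    rewrite distrC; apply: yE => //; exact: ltW].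
have grow s t : 0 <= s -> s <= t -> t <= T ->
    `|u t - u xi| <= K0 * (`|u s - u xi| + E).
  move=> s0 st tT; apply: (@le_trans _ _ (expR ((2 * L + 1) * (t - s)) * (`|u s - u xi| + E))).
    apply: (@gronwall R (fun x => u x - u xi) (fun x => y x - H (u x)) s t L E) => //.
    - by move=> x; apply: cvgB; [exact: uc|exact: cvg_cst].
    - move=> x /andP[sx xt].
      have ? : is_derive x (1 : R) u (y x - H (u x)).
        by apply: ud; rewrite (le_lt_trans s0 sx) (lt_le_trans xt).
      by apply: is_derive_eq; rewrite subr0.
    - move=> x /andP[sx xt]; apply: dvE.
      by rewrite (le_trans s0 (ltW sx)) (le_trans (ltW xt)).
  rewrite ler_wpM2r ?addr_ge0 // ler_expR ler_wpM2l //.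
  by rewrite lerBlDr (le_trans tT) // lerDl.
(* [gronwall] runs forward only: from [xi] to [T], and then, as [u T = u 0], from [0] to any
   time. *)
have u0E : `|u 0 - u xi| <= K0 * E.
  by have := grow _ _ (ltW xi0) (ltW xiT') (lexx T); rewrite uT subrr normr0 add0r.
have uE t : 0 <= t <= T -> `|u t - u xi| <= K0 * (K0 + 1) * E.
  move=> /andP[t0' tT]; apply: le_trans (grow _ _ (lexx 0) t0' tT) _.
  by rewrite -mulrA ler_wpM2l // mulrDl mul1r lerD2r.
have uMC t : 0 <= t <= T -> `|u t - M| <= C3 * n * M.
  move=> tT; rewrite -ut0 -(subrKA (u xi)); apply: le_trans (ler_normD _ _) _.
  apply: le_trans (lerD (uE _ tT) (_ : _ <= K0 * (K0 + 1) * E)) _.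
    by rewrite distrC uE.
  by rewrite /C3 /E ut0 le_eqVlt; apply/orP; left; apply/eqP; ring.
have gut t : 0 <= t <= T -> `|g (clamp b (u t)) - g M| <= e * g M.
  move=> tT; have h := uMC _ tT.
  have hM : C3 * n * M < M.
    by rewrite gtr_pMl //; apply: lt_le_trans Cn _; rewrite ge_min lexx orbT.
  have ut : 0 < u t by move: h; rewrite ler_norml => /andP[h _]; lra.
  rewrite clamp_id; last by rewrite (ltW ut) (le_trans (uM _ tT)).
  have -> : u t = (u t / M) * M by rewrite divfK ?gt_eqF.
  apply: ro; first by rewrite M0.
  have -> : u t / M - 1 = (u t - M) / M by rewrite mulrBl divff ?gt_eqF.
  rewrite normrM [`|M^-1|]gtr0_norm ?invr_gt0 // ltr_pdivrMr //.
  apply: le_lt_trans h _; rewrite ltr_pM2r //; apply: lt_le_trans Cn _.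
  by rewrite ge_min lexx.
have gM0 : 0 <= g M by rewrite g_ge0 // ltW.
(* [z' = al (g M - g u)] is small compared with [g M]. *)
pose z x := y x + g M * S x.
have zc : continuous z.
  move=> x; apply: cvgD; first exact: yc.
  by apply: cvgM; [exact: cvg_cst|exact: Sc].
(* [al] may jump at [D], so the mean value theorem is applied on each side of [D]. *)
have piece s t : 0 <= s -> s < t -> t <= T -> (forall x, s < x < t -> x != D) ->
    - (A * (e * g M)) * (t - s) <= z t - z s.
  move=> s0 st tT xD.
  have zd x : x \in `]s, t[ ->
      is_derive x (1 : R) z (al x * (g M - g (clamp b (u x)))).
    rewrite in_itv /= => sxt; have /andP[sx xt] := sxt.
    have xT : 0 < x < T by rewrite (le_lt_trans s0 sx) (lt_le_trans xt).
    have alx := alc _ xT (xD _ sxt).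
    have ? : is_derive x (1 : R) S (al x) by exact: (primitive_is_derive dS).
    have ? : is_derive x (1 : R) y (- (al x * g (clamp b (u x)))).
      apply: (primitive_is_derive dy) => //; apply: cvgN; apply: cvgM => //.
      exact: (continuous_comp (@uc x) (@gc (u x))).
    by apply: is_derive_eq; rewrite /GRing.scale /=; ring.
  have [c] := MVT st zd (continuous_subspaceT zc).
  rewrite in_itv /= => /andP[sc ct] ->; rewrite ler_pM2r ?subr_gt0 //.
  have : `|al c * (g M - g (clamp b (u c)))| <= A * (e * g M).
    rewrite normrM; apply: ler_pM => //; rewrite distrC gut //.
    by rewrite (le_trans s0 (ltW sc)) (le_trans (ltW ct)).
  by rewrite ler_norml => /andP[].
have p1 : - (A * (e * g M)) * (D - 0) <= z D - z 0.
  by apply: piece => // [|x /andP[_ xD]]; [exact: ltW|rewrite lt_eqF].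
have p2 : - (A * (e * g M)) * (T - D) <= z T - z D.
  by apply: piece => // [|x /andP[Dx _]]; [exact: ltW|rewrite gt_eqF].
have p : - (A * (e * g M)) * T <= z T - z 0.
  have := lerD p1 p2; rewrite -mulrDr => h.
  have -> : z T - z 0 = z D - z 0 + (z T - z D) by ring.
  by apply: le_trans h; rewrite subr0 subrKC.
have Ae : A * e * T <= sigma.
  have -> : A * e * T = sigma * (A * T / (A * T + 1)) by rewrite /e; ring.
  by rewrite ger_pMr // ler_pdivrMr ?ltr_wpDl // mul1r lerDl.
have zz : z T - z 0 = y T - y 0 - g M * sigma.
  have -> : z T - z 0 = y T - y 0 + g M * (S T - S 0) by rewrite /z; ring.
  by rewrite ST mulrN.
have : A * e * T * g M <= sigma * g M by rewrite ler_wpM2r.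
have : - (A * (e * g M)) * T = - (A * e * T * g M) by ring.
move: p; rewrite zz (mulrC (g M)); lra.
Qed.

End SmallSolutions.

(** * Continuous extensions, limits and null sets *)

Section Helpers.
Variable R : realType.
Implicit Types (f F g : R -> R) (a b x : R).

(** With [k] a projection into [D], this extends [f] to a continuous function on the line. *)
Lemma within_continuous_comp (D : set R) f (k : R -> R) :
  {within D, continuous f} -> continuous k -> (forall x, D (k x)) ->
  continuous (fun x => f (k x)).
Proof.
move=> /subspace_continuousP fD kc kD x; apply: cvg_comp (fD _ (kD x)).
move=> U hU; have h : nbhs x [set z | D (k z) -> U (k z)] := kc x _ hU.
suff : nbhs x [set z | U (k z)] by [].
by apply: filterS h => z; apply.
Qed.

Lemma clamp_continuous b : 0 <= b -> continuous (@clamp R b).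
Proof.
move=> b0; apply: (@lipschitz_continuous _ _ 1) => s t; rewrite mul1r.
exact: clamp_dist.
Qed.

Lemma max0_dist x y : `|Num.max 0 x - Num.max 0 y| <= `|x - y|.
Proof.
have := ler_norm (x - y); have := ler_norm (y - x); rewrite distrC => h1 h2.
by have [x0|x0] := leP 0 x; have [y0|y0] := leP 0 y; rewrite ?subrr ?normr0 //;
  rewrite ler_norml; apply/andP; split; lra.
Qed.

Lemma max0_continuous : continuous (fun x : R => Num.max 0 x).
Proof.
apply: (@lipschitz_continuous _ _ 1) => s t; rewrite mul1r; exact: max0_dist.
Qed.

Lemma is_derive_primitive f F a b : {within `[a, b], continuous F} ->
  (forall x, a < x < b -> is_derive x (1 : R) F (f x)) -> primitive f F a b.
Proof.
move=> Fc dF s t k as_; rewrite le_eqVlt => /orP[/eqP->|st] tb.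
  by rewrite !subrr mulr0.
have [||c] := @MVT R F f s t st.
- move=> x; rewrite in_itv /= => /andP[sx xt]; apply: dF.
  by rewrite (le_lt_trans as_ sx) (lt_le_trans xt).
- apply: continuous_subspaceW Fc => x /=; rewrite !in_itv /= => /andP[sx xt].
  by rewrite (le_trans as_) // (le_trans xt).
rewrite in_itv /= => cst ->.
by split=> h; rewrite ler_pM2r ?subr_gt0 //; exact: h.
Qed.

(** Taking the last maximum point contradicts any propagation of the maximum to the right. *)
Lemma last_point u T M : continuous u -> (exists2 t : R, 0 <= t <= T & u t = M) ->
  exists2 x : R, 0 <= x <= T /\ u x = M & forall t, x < t <= T -> u t != M :> R.
Proof.
move=> uc [t0 t0T ut0]; pose X := [set t | 0 <= t <= T /\ u t = M].
have X0 : X t0 by [].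
have Xub : ubound X T by move=> t [/andP[]].
have Xsup : has_sup X by split; [exists t0|exists T].
have supX t : X t -> t <= sup X by exact: ub_le_sup (proj2 Xsup) _.
exists (sup X); last first.
  move=> t /andP[xt tT]; apply/eqP => utM; have /supX : X t.
    split=> //; rewrite tT andbT (le_trans _ (ltW xt)) //.
    by apply: le_trans (supX _ X0); case/andP: t0T.
  by rewrite leNgt xt.
split.
  apply/andP; split; first by apply: le_trans (supX _ X0); case/andP: t0T.
  by apply: ge_sup Xub; exists t0.
apply/eqP/negPn/negP => uM.
have e0 : 0 < `|u (sup X) - M| by rewrite normr_gt0 subr_eq0.
have [d d0 hd] := continuous_dist (@uc (sup X)) e0.
have [t Xt tsup] := sup_adherent d0 Xsup.
have : `|u t - u (sup X)| < `|u (sup X) - M|.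
  apply: hd; rewrite distrC ger0_norm ?subr_ge0 ?supX //; lra.
by have [_ ->] := Xt; rewrite distrC ltxx.
Qed.

Lemma ae_exists (P : R -> Prop) a b : {ae @lebesgue_measure R, forall x, P x} ->
  a < b -> exists2 x, a < x < b & P x.
Proof.
move=> aeP ab; apply: contrapT => noP.
have : (@lebesgue_measure R).-negligible `]a, b[%classic.
  apply: negligibleS aeP => x /=; rewrite in_itv /= => axb Px.
  by apply: noP; exists x.
move=> /negligibleP => /(_ (measurable_itv _)).
have /= -> := lebesgue_measure_itv `]a, b[; rewrite lte_fin ab.
by move=> /eqP; rewrite -EFinD eqe subr_eq0 gt_eqF.
Qed.

Lemma negligible_pair a b : (@lebesgue_measure R).-negligible [set x | x = a \/ x = b].
Proof.
have h (c : R) : (@lebesgue_measure R).-negligible [set c].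
  by apply/negligibleP => //; exact: lebesgue_measure_set1.
apply: negligibleS (negligibleU (h a) (h b)) => x [->|->]; [by left|by right].
Qed.

Lemma small_quotient g : (g s / s @[s --> 0^'+] --> (0 : R)) ->
  forall e : R, 0 < e -> exists2 d : R, 0 < d & forall s : R, 0 < s < d -> g s <= e * s.
Proof.
move=> /cvgrPdist_lt h e /h [d /= d0 hd]; exists d => // s /andP[s0 sd].
have := hd s; rewrite /= sub0r normrN gtr0_norm // => /(_ sd s0).
rewrite sub0r normrN => /(le_lt_trans (ler_norm _)) /ltW.
by rewrite ler_pdivrMr.
Qed.

Lemma large_quotient g : (g s / s @[s --> +oo] --> +oo) ->
  forall K : R, exists2 s0 : R, 0 < s0 & forall s : R, s0 <= s -> K * s <= g s.
Proof.
move=> /cvgryPge h K; have [M [_ hM]] := h K.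
exists (`|M| + 1) => [|s sM]; first by rewrite ltr_wpDl.
have s0 : 0 < s by apply: lt_le_trans sM; rewrite ltr_wpDl.
rewrite -ler_pdivlMr //; apply: hM; apply: lt_le_trans sM.
by apply: le_lt_trans (ler_norm M) _; rewrite ltrDl.
Qed.

Lemma regular_oscillation g : (forall s : R, 0 < s -> 0 < g s) ->
  regularly_oscillating_at_zero g ->
  forall e : R, 0 < e -> exists2 d : R, 0 < d &
    forall s w : R, 0 < s < d -> `|w - 1| < d -> `|g (w * s) - g s| <= e * g s.
Proof.
move=> gpos /cvgrPdist_lt h e e0.
have [[U V] /= [[d1 /= d10 U1] [d2 /= d20 V2]] UV] := h e e0.
exists (Num.min d1 d2); first by rewrite lt_min d10.
move=> s w /andP[s0]; rewrite !lt_min => /andP[sd1 _] /andP[_ wd2].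
(* The filter at [1] is punctured, so [w = 1] is settled apart. *)
have [->|w1] := eqVneq w 1.
  by rewrite mul1r subrr normr0 mulr_ge0 ?ltW ?gpos.
have Us : U s by apply: U1 => //; rewrite /= sub0r normrN gtr0_norm.
have Vw : V w by apply: V2 => //; rewrite /= distrC.
have /= := UV (s, w) (conj Us Vw); have gs := gpos _ s0.
have -> : 1 - g (w * s) / g s = (g s - g (w * s)) / g s.
  by rewrite mulrBl divff // gt_eqF.
by rewrite normrM [`|_^-1|]gtr0_norm ?invr_gt0 // ltr_pdivrMr // distrC => /ltW.
Qed.

End Helpers.

(** * Truncation, shooting and elimination of the jump *)

Section PeriodicSystem.
Variables (R : realType) (T L A D : R) (h H g al S : R -> R) (m : nat).
(** [Z i] stands for the [i]-th interval of nonnegative weight, in rotated time; [no_max] and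
    [outside] are all that the argument uses about these intervals. *)
Variable Z : 'I_m -> R -> Prop.
Hypotheses (T0 : 0 < T) (L0 : 0 <= L) (A0 : 0 <= A) (DT : 0 < D < T).
Hypotheses (hL : forall s : R, `|h s| <= L).
Hypothesis dH : forall s : R, 0 <= s -> is_derive s (1 : R) H (h s).
Hypothesis H0 : H 0 = 0.
Hypothesis g_ge0 : forall s : R, 0 <= s -> 0 <= g s.
Hypothesis g0 : g 0 = 0.
Hypothesis gc : forall b : R, 0 <= b -> continuous (fun s => g (clamp b s)).
Hypothesis g_small : forall e : R, 0 < e ->
  exists2 d : R, 0 < d & forall s : R, 0 < s < d -> g s <= e * s.
Hypothesis g_ro : forall e : R, 0 < e -> exists2 d : R, 0 < d &
  forall s w : R, 0 < s < d -> `|w - 1| < d -> `|g (w * s) - g s| <= e * g s.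
Hypothesis alA : forall t, `|al t| <= A.
Hypothesis al_cont : forall x : R, 0 < x < T -> x != D -> {for x, continuous al}.
Hypotheses (Sc : continuous S) (dS : primitive al S 0 T) (ST : S T - S 0 < 0).
Hypothesis no_max : forall i, exists M0 : R, 0 < M0 /\
  forall (M x1 : R) (gM u y : R -> R), M0 <= M ->
    continuous gM -> continuous u -> continuous y ->
    (forall v : R, 0 <= v <= M -> gM v = g v) ->
    primitive (fun v => y v - H (u v)) u 0 T ->
    primitive (fun v => - (al v * gM (u v))) y 0 T ->
    (forall v : R, 0 <= v <= T -> 0 < u v <= M) ->
    0 <= x1 <= T -> Z i x1 -> u x1 = M -> False.
Hypothesis outside : forall x : R, 0 <= x <= T -> (forall i, ~ Z i x) ->
  0 < x < T /\ exists2 z : R, x < z <= T & forall v : R, x < v < z -> al v <= 0.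

Lemma periodic_system : exists u y : R -> R,
  [/\ continuous u /\ continuous y, forall t : R, 0 <= t <= T -> 0 < u t,
      primitive (fun t => y t - H (u t)) u 0 T,
      primitive (fun t => - (al t * g (u t))) y 0 T &
      u T = u 0 /\ y T = y 0].
Proof.
have sigma0 : 0 < - (S T - S 0) by rewrite oppr_gt0.
have [r r0 small] := small_solutions T0 L0 A0 sigma0 g_ge0 g0 g_small g_ro.
have [Mi MiP] := choice no_max.
have Mi0 i : 0 < Mi i by have [] := MiP i.
(* A sum dominates [r] and all thresholds [Mi i] at once; the truncation level [b] is one unit above
   it. *)
pose Rs := r + \sum_i Mi i.
have MiRs i : Mi i <= Rs.
  rewrite /Rs (bigD1 i) //= addrCA lerDl addr_ge0 ?(ltW r0) // sumr_ge0 // => j _.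
  exact: ltW.
have rRs : r <= Rs by rewrite lerDl sumr_ge0 // => i _; exact: ltW.
have Rs0 : 0 < Rs by exact: lt_le_trans rRs.
pose b := Rs + 1; have b0 : 0 <= b by rewrite addr_ge0 // ltW.
have Rsb : Rs < b by rewrite ltrDl.
pose Hb s := H (clamp b s); pose gb s := g (clamp b s).
have HbL s t : `|Hb s - Hb t| <= L * `|s - t|.
  apply: (@le_trans _ _ (L * `|clamp b s - clamp b t|)).
    apply: (@is_derive_lipschitz _ H h 0 b); rewrite ?clamp_itv //.
    by move=> x /andP[x0 _]; exact: dH.
  by rewrite ler_wpM2l // clamp_dist.
have Hb0 s : s <= 0 -> Hb s = 0 by move=> s0; rewrite /Hb clamp_le0.
have HbB s : `|Hb s| <= L * b.
  have h0 : Hb 0 = 0 by exact: Hb0.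
  have := HbL (clamp b s) 0; rewrite h0 !subr0.
  have /andP[c0 cb] := clamp_itv s b0.
  rewrite {1}/Hb (clamp_id (_ : 0 <= clamp b s <= b)) ?c0 // (ger0_norm c0) => hh.
  by apply: le_trans hh _; rewrite ler_wpM2l.
have Hbu := lipschitz_unif_cont HbL.
have gbc : continuous gb by exact: gc.
have gb_clamp s : gb (clamp b s) = gb s by rewrite /gb (clamp_id (clamp_itv s b0)).
have gbu : unif_cont gb.
  have -> : gb = (fun s => gb (clamp b s)) by apply/funext => s; rewrite gb_clamp.
  exact: unif_cont_clamp.
have gb_ge0 s : 0 <= gb s by apply: g_ge0; case/andP: (clamp_itv s b0).
have [Gm gG] : exists Gm, forall s, `|gb s| <= Gm.
  have [c _ gmax] := EVT_max b0 (continuous_subspaceT gbc).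
  exists (gb c) => s; rewrite ger0_norm // -gb_clamp; apply: gmax.
  by rewrite in_itv /= clamp_itv.
have Gm0 : 0 <= Gm by apply: le_trans (gG 0); exact: normr_ge0.
(* The linear bound that [positivity] asks for: from [g_small] below [d], from boundedness beyond
   [d]. *)
have [K1 K10 gK] : exists2 K1 : R, 0 <= K1 & forall s, gb s <= K1 * Num.max 0 s.
  have [d d0 gd] := g_small ltr01.
  exists (1 + Gm / d) => [|s]; first by rewrite addr_ge0 // divr_ge0 // ltW.
  have [s0|s0] := leP s 0; first by rewrite /gb clamp_le0 // g0 mulr0.
  have cs : clamp b s <= s.
    by rewrite /clamp ge_max (ltW s0) ge_min lexx.
  rewrite mulrDl mul1r; have [sd|ds] := ltP s d.
    apply: (@le_trans _ _ s); last by rewrite lerDl mulr_ge0 ?divr_ge0 // ltW.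
    have /andP[] := clamp_itv s b0; rewrite le_eqVlt => /orP[/eqP e|c0] _.
      by rewrite /gb -e g0 ltW.
    by apply: le_trans (gd (clamp b s) _) _; rewrite ?mul1r // c0 (le_lt_trans cs).
  apply: le_trans (ler_norm _) (le_trans (gG s) _).
  rewrite -[leLHS]add0r lerD ?(ltW s0) // mulrAC ler_pdivlMr //.
  by rewrite ler_wpM2l.
pose C := A * Gm * T.
have C0 : 0 <= C by exact: mulr_ge0 (mulr_ge0 A0 Gm0) (ltW T0).
(* The slope beyond [Rs] exceeds the a priori bound [C] on the jump of [y], which
   keeps the maximum of the solution below [b]. *)
pose phi s := Num.max 0 (r - s) - (C + 1) * Num.max 0 (s - Rs).
have phiu : unif_cont phi.
  apply: (@lipschitz_unif_cont _ _ (C + 2)) => s t.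
  have -> : phi s - phi t = (Num.max 0 (r - s) - Num.max 0 (r - t)) +
      - ((C + 1) * (Num.max 0 (s - Rs) - Num.max 0 (t - Rs))) by rewrite /phi; ring.
  have -> : (C + 2) * `|s - t| = `|s - t| + (C + 1) * `|s - t| by ring.
  apply: le_trans (ler_normD _ _) _; apply: lerD.
    apply: le_trans (max0_dist _ _) _; rewrite distrC le_eqVlt; apply/orP; left.
    by apply/eqP; congr `|_|; ring.
  rewrite normrN normrM ger0_norm ?addr_ge0 // ler_wpM2l ?addr_ge0 //.
  apply: le_trans (max0_dist _ _) _; rewrite le_eqVlt; apply/orP; left.
  by apply/eqP; congr `|_|; ring.
(* [D'] is the displacement bound of [shooting] for [Hm = L * b]. [N] is so large that below
   [- N + D'] the term [r - s] exceeds [C], and that [N >= b]. *)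
pose D' := (C + L * b + 1 + C + L * b) * T.
have Lb0 : 0 <= L * b by exact: mulr_ge0.
have D'0 : 0 <= D' by rewrite mulr_ge0 ?addr_ge0 // ltW.
pose N := D' + C + 1 + b.
have N0 : 0 < N by rewrite ltr_wpDr // ltr_wpDl ?addr_ge0.
have phi_lo s : s <= - N + D' -> C < phi s.
  rewrite /N => sN; have s1 : s <= - (C + 1 + b) by move: sN; rewrite /D'; lra.
  rewrite /phi (max_l (_ : s - Rs <= 0)); last first.
    rewrite subr_le0; apply: le_trans s1 _; apply: le_trans (ltW Rs0).
    by rewrite oppr_le0; exact: addr_ge0 (addr_ge0 C0 ler01) b0.
  rewrite mulr0 subr0 lt_max; apply/orP; right; move: s1 r0 b0; lra.
have phi_hi s : N <= s -> phi s < - C.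
  rewrite /N => sN; have s1 : b <= s by move: sN D'0 C0; rewrite /D'; lra.
  have s2 : r <= s by apply: le_trans rRs (le_trans (ltW Rsb) s1).
  rewrite /phi max_l ?subr_le0 // max_r; last first.
    by rewrite subr_ge0 (le_trans (ltW Rsb)).
  have s3 : 1 <= s - Rs by rewrite lerBrDr addrC.
  rewrite sub0r ltrN2; apply: (@lt_le_trans _ _ (C + 1)); first by rewrite ltrDl.
  by rewrite ler_peMr // addr_ge0.
have [u [y [M [[uc yc] du dy [uT yT] [uM uatt]]]]] :=
  shooting T0 N0 Hbu gbu phiu alA gG HbB phi_lo phi_hi.
have jump : `|y T - y 0| <= C.
  apply: (@le_trans _ _ (A * Gm * (T - 0))); last by rewrite subr0.
  apply: (primitive_bound dy) => //; first exact: ltW.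
  by move=> x _; rewrite normrN normrM ler_pM.
have rM : r <= M.
  rewrite leNgt; apply/negP => Mr.
  have rb : r <= b by exact: le_trans (ltW Rsb).
  have := small b D M al Hb S u y rb alA HbL DT al_cont Sc dS.
  rewrite opprK => /(_ erefl gbc uc yc du dy uT uM uatt (ltW Mr)).
  rewrite yT leNgt => /negP; apply; rewrite oppr_lt0 /phi.
  rewrite max_r ?subr_ge0 ?(ltW Mr) // max_l ?mulr0 ?subr0 ?subr_gt0 //.
  by rewrite subr_le0 (le_trans (ltW Mr)).
have M0 : 0 < M by exact: lt_le_trans rM.
have phiM : phi M = - ((C + 1) * Num.max 0 (M - Rs)).
  by rewrite /phi max_l ?subr_le0 // sub0r.
have yT0 : y T - y 0 = (C + 1) * Num.max 0 (M - Rs) by rewrite yT phiM opprK.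
have Mb : M <= b.
  have [MRs|RsM] := leP M Rs; first by apply: le_trans (ltW Rsb).
  move: jump; rewrite yT0 max_r ?subr_ge0 ?(ltW RsM) // => jump.
  have := le_trans (ler_norm _) jump => {}jump.
  rewrite /b -lerBlDl leNgt; apply/negP => h1.
  have : C + 1 <= (C + 1) * (M - Rs) by rewrite ler_peMr ?addr_ge0 // ltW.
  by move=> /le_trans /(_ jump); rewrite gerDl ler10.
have y0T : y 0 <= y T.
  by rewrite -subr_ge0 yT0 mulr_ge0 ?addr_ge0 // le_max lexx.
have upos : forall t, 0 <= t <= T -> 0 < u t.
  apply: (positivity T0 L0 A0 uc yc HbL alA gb_ge0 du dy K10 gK Hb0 uT y0T).
  by have [t tT ut] := uatt; exists t => //; rewrite ut.
(* The truncation is inactive on the range of [u]. *)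
have ub t : 0 <= t <= T -> clamp b (u t) = u t.
  by move=> tT; rewrite clamp_id // ltW ?upos // (le_trans (uM _ tT)).
have oo_cc t : 0 < t < T -> 0 <= t <= T by move=> /andP[? ?]; rewrite !ltW.
have du' : primitive (fun t => y t - H (u t)) u 0 T.
  by apply: (primitive_eq du) => // t /oo_cc tT; rewrite /Hb ub.
exists u, y; split => //.
  by apply: (primitive_eq dy) => // t /oo_cc tT; rewrite /gb ub.
split=> //; apply/eqP; rewrite -subr_eq0 yT0 mulf_eq0; apply/orP; right.
have [MRs|RsM] := leP M Rs; first by rewrite max_l ?subr_le0.
have [x1 [x1T ux1] x1last] := last_point uc uatt.
have uM' v : 0 <= v <= T -> 0 < u v <= M by move=> vT; rewrite upos // uM.
exfalso; have [[i Zi]|noZ] := pselect (exists i, Z i x1).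
  have [_ /(_ M x1 gb u y)] := MiP i; apply => //.
  - exact: le_trans (MiRs i) (ltW RsM).
  - by move=> v /andP[v0 vM]; rewrite /gb clamp_id // v0 (le_trans vM).
have [|/andP[x10 x1T'] [z /andP[x1z zT] alz]] := outside x1T.
  by move=> i Zi; apply: noZ; exists i.
have : u z = u x1.
  apply: (max_propagation L0 uc yc HbL gb_ge0 du dy x10 (ltW x1z) zT _ alz).
  by move=> s sT; rewrite ux1 uM.
rewrite ux1 => uz; have := x1last z; rewrite x1z zT uz eqxx => /(_ isT).
by [].
Qed.

End PeriodicSystem.

(** * Sign of the weight and rotation of the period *)

Section Weight.
Variables (R : realType) (f : R -> R).
Hypothesis fc : continuous f.

Lemma continuous_pos_nbhs x : 0 < f x -> exists2 d : R, 0 < d &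
  forall y, `|y - x| < d -> f x / 2 < f y.
Proof.
move=> fx; have e0 : 0 < f x / 2 by rewrite divr_gt0.
have [d d0 hd] := continuous_dist (@fc x) e0; exists d => // y /hd.
by rewrite ltr_norml => /andP[h _]; lra.
Qed.

(** A positive value would persist, by continuity, on an interval, which is not a null set. *)
Lemma ae_le0_itv (P : R -> Prop) (a b : R) :
  {ae @lebesgue_measure R, forall x, P x -> f x <= 0} ->
  (forall x, a < x < b -> P x) -> forall x, a < x < b -> f x <= 0.
Proof.
move=> faeP abP x /andP[ax xb]; rewrite leNgt; apply/negP => fx.
have [d d0 hd] := continuous_pos_nbhs fx.
have xz : x < Num.min b (x + d) by rewrite lt_min xb ltrDl.
have [y /andP[xy]] := ae_exists faeP xz.
rewrite lt_min => /andP[yb yd] Py.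
have : f x / 2 < f y by apply: hd; rewrite gtr0_norm ?subr_gt0 // ltrBlDr addrC.
rewrite ltNge (le_trans (Py _)) ?ltW ?divr_gt0 //.
by apply: abP; rewrite (lt_trans ax).
Qed.

(** The two ends are a null set, so a nonzero value occurs inside; it is positive and persists
    nearby. *)
Lemma positive_subinterval (l r : R) : (forall x, l < x < r -> 0 <= f x) ->
  ~ {ae @lebesgue_measure R, forall x, x \in `[l, r] -> f x = 0} ->
  exists s t a0 : R, [/\ l < s, s < t, t < r, 0 < a0 & forall x, s <= x <= t -> a0 <= f x].
Proof.
move=> f0 nae; apply: contrapT => nsub; apply: nae.
apply: negligibleS (negligible_pair l r) => x /=; rewrite in_itv /= => nfx.
have [lx|] := ltP l x; last first.
  by rewrite le_eqVlt => /orP[/eqP->|xl]; [left|case: nfx => /andP[/(lt_le_trans xl)]; rewrite ltxx].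
have [xr|] := ltP x r; last first.
  by rewrite le_eqVlt => /orP[/eqP->|rx]; [right|case: nfx => /andP[_ /(lt_le_trans rx)]; rewrite ltxx].
exfalso; apply: nfx => _; apply/eqP; rewrite eq_le f0 ?lx // andbT leNgt; apply/negP => fx.
have [d d0 hd] := continuous_pos_nbhs fx; apply: nsub.
pose e := Num.min (d / 2) (Num.min ((x - l) / 2) ((r - x) / 2)).
have e0 : 0 < e by rewrite !lt_min !divr_gt0 ?subr_gt0.
have [ed [el er]] : e <= d / 2 /\ e <= (x - l) / 2 /\ e <= (r - x) / 2.
  by rewrite /e !ge_min !lexx !orbT.
exists (x - e), (x + e), (f x / 2); split; try lra.
move=> y /andP[y1 y2]; apply/ltW/hd; rewrite ltr_norml; apply/andP; split; lra.
Qed.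

End Weight.

(** Finitely many closed intervals that miss [x] also miss a right neighbourhood of [x], and [x < T]
    leaves room for it. *)
Lemma outside_right (R : realType) (f : R -> R) (T x : R) (m : nat) (l r : 'I_m -> R) :
  continuous f -> {ae @lebesgue_measure R, forall x, x \in `[0, T] ->
    (forall i, x \notin `[l i, r i]) -> f x <= 0} ->
  0 <= x < T -> (forall i, x \notin `[l i, r i]) ->
  exists2 z, x < z <= T & forall v, x < v < z -> f v <= 0.
Proof.
move=> fc fae /andP[x0 xT] xI.
have : \forall v \near x^'+, forall i, v \notin `[l i, r i].
  apply: filter_forall => i; have := xI i; rewrite in_itv /= negb_and -!ltNge.
  move=> /orP[xl|rx].
    near=> v; rewrite in_itv /= negb_and -!ltNge; apply/orP; left.
    near: v; exact: nbhs_right_lt.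
  near=> v; rewrite in_itv /= negb_and -!ltNge; apply/orP; right.
  by apply: (lt_trans rx); near: v; exact: nbhs_right_gt.
move=> [d /= d0 hd].
exists (Num.min T (x + d)); first by rewrite lt_min xT ltrDl d0 ge_min lexx.
apply: (@ae_le0_itv _ f fc (fun v => v \in `[0, T] /\ forall i, v \notin `[l i, r i])).
  by apply: negligibleS fae => v /= nh h; apply: nh => -[vT vI]; exact: h.
move=> v /andP[xv]; rewrite lt_min => /andP[vT vd]; split.
  by rewrite in_itv /= (le_trans x0 (ltW xv)) ltW.
move=> i; apply: (hd v) => //=; rewrite distrC gtr0_norm ?subr_gt0 //.
by rewrite ltrBlDr addrC.
Unshelve. all: by end_near. Qed.

Section Glue.
Variables (R : realType) (T c : R) (a al u y H g : R -> R).
Hypotheses (T0 : 0 < T) (cT : 0 < c < T).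
Hypothesis al1 : forall t, 0 < t < T - c -> al t = a (t + c).
Hypothesis al2 : forall t, T - c < t < T -> al t = a (t - (T - c)).
Hypotheses (uc : continuous u) (yc : continuous y).
Hypothesis du : primitive (fun t => y t - H (u t)) u 0 T.
Hypothesis dy : primitive (fun t => - (al t * g (u t))) y 0 T.
Hypotheses (uT : u T = u 0) (yT : y T = y 0).

(* As [clamp T] saturates, this is [w (x + (T - c))] on [0, c] and, when
   [w T = w 0], [w (x - c)] on [c, T]. *)
Definition unrotate (w : R -> R) x := w (clamp T (x + (T - c))) + w (clamp T (x - c)) - w 0.

Let c0 : 0 < c. Proof. by case/andP: cT. Qed.
Let cT' : c < T. Proof. by case/andP: cT. Qed.

Lemma unrotate_left w x : 0 <= x <= c -> unrotate w x = w (x + (T - c)).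
Proof.
move=> /andP[x0 xc]; rewrite /unrotate (clamp_le0 _ (_ : x - c <= 0)) ?subr_le0 //.
rewrite addrK clamp_id // addr_ge0 ?subr_ge0 ?(ltW cT') //=.
by rewrite addrCA gerDl subr_le0.
Qed.

Lemma unrotate_right w x : w T = w 0 -> c <= x <= T -> unrotate w x = w (x - c).
Proof.
move=> wT /andP[cx xT]; rewrite /unrotate.
have -> : clamp T (x + (T - c)) = T.
  by rewrite /clamp min_r ?max_r ?(ltW T0) // addrCA lerDl subr_ge0.
rewrite wT addrC addKr clamp_id // subr_ge0 cx /=.
by rewrite lerBlDr (le_trans xT) // lerDl ltW.
Qed.

Lemma unrotate_continuous w : continuous w -> continuous (unrotate w).
Proof.
move=> wc x; have cl := clamp_continuous (ltW T0).
apply: cvgB; last exact: cvg_cst.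
apply: cvgD; (apply: continuous_comp; last exact: wc);
  (apply: continuous_comp; last exact: cl).
  by apply: cvgD; [|exact: cvg_cst].
by apply: cvgB; [|exact: cvg_cst].
Qed.

Lemma unrotate_itv w x : w T = w 0 -> 0 <= x <= T ->
  exists2 t, 0 <= t <= T & unrotate w x = w t.
Proof.
move=> wT /andP[x0 xT]; have [xc|/ltW cx] := leP x c.
  exists (x + (T - c)); last by rewrite unrotate_left // x0.
  by rewrite addr_ge0 ?subr_ge0 ?(ltW cT') //= addrCA gerDl subr_le0.
exists (x - c); last by rewrite unrotate_right // cx.
by rewrite subr_ge0 cx lerBlDr (le_trans xT) // lerDl ltW.
Qed.

(** Both pieces are shifts of [w], and [w T = w 0] makes them agree at [c]. *)
Lemma unrotate_primitive (w f f' : R -> R) : w T = w 0 -> primitive f w 0 T ->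
  (forall x, 0 < x < c -> f' x = f (x + (T - c))) ->
  (forall x, c < x < T -> f' x = f (x - c)) ->
  primitive f' (unrotate w) 0 T.
Proof.
move=> wT dw f1 f2; apply: (primitive_cat (ltW c0) (ltW cT')).
  apply: (@primitive_eq _ (fun x => f (x + (T - c))) (fun x => w (x + (T - c)))) => //.
    apply: primitive_shift; apply: (primitive_sub dw).
      by rewrite add0r subr_ge0 ltW.
    by rewrite addrC subrK.
  by move=> x /unrotate_left.
apply: (@primitive_eq _ (fun x => f (x - c)) (fun x => w (x - c))) => //.
  apply: primitive_shift; apply: (primitive_sub dw); first by rewrite subrr.
  by rewrite gerDl oppr_le0 ltW.
by move=> x /unrotate_right ->.
Qed.

Lemma unrotate_period w : w T = w 0 -> unrotate w 0 = unrotate w T.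
Proof.
move=> wT; rewrite unrotate_left ?lexx ?(ltW c0) // add0r.
by rewrite unrotate_right ?lexx ?(ltW cT').
Qed.

Lemma unrotate_system :
  primitive (fun t => unrotate y t - H (unrotate u t)) (unrotate u) 0 T /\
  primitive (fun t => - (a t * g (unrotate u t))) (unrotate y) 0 T.
Proof.
have left x : 0 < x < c -> 0 <= x <= c by move=> /andP[? ?]; rewrite !ltW.
have right x : c < x < T -> c <= x <= T by move=> /andP[? ?]; rewrite !ltW.
split.
  apply: (unrotate_primitive uT du) => x.
    by move=> /left h; rewrite !unrotate_left.
  by move=> /right h; rewrite !unrotate_right.
apply: (unrotate_primitive yT dy) => x h.
  rewrite unrotate_left ?left // al2 ?addrK //.
  by move: h => /andP[x0 xc]; rewrite ltrDr x0 addrCA gtrDl subr_lt0.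
rewrite unrotate_right ?right // al1 ?subrK //.
by move: h => /andP[cx xT]; rewrite subr_gt0 cx ltrD2r.
Qed.

End Glue.

(** * Return to the second order equation *)

Section Classical.
Variables (R : realType) (T : R) (a h g H U Y : R -> R).
Hypotheses (T0 : 0 < T) (ac : continuous a) (hc : continuous h).
Hypothesis gc : continuous (fun s : R => g (Num.max 0 s)).
Hypothesis dH : forall s : R, 0 <= s -> is_derive s (1 : R) H (h s).
Hypotheses (Uc : continuous U) (Yc : continuous Y).
Hypothesis Upos : forall t : R, 0 <= t <= T -> 0 < U t.
Hypothesis dU : primitive (fun t => Y t - H (U t)) U 0 T.
Hypothesis dY : primitive (fun t => - (a t * g (U t))) Y 0 T.
Hypotheses (U0T : U 0 = U T) (Y0T : Y 0 = Y T).

(** In the original time the weight is continuous, so the primitives become classical derivatives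
    and [U1 = Y - H (U)] is differentiable. *)
Lemma primitive_periodic_solution : periodic_solution T h a g U.
Proof.
pose U1 x := Y x - H (U x).
(* [Num.max 0] makes [g] continuous on the whole line and changes nothing on the positive values of
   [U]. *)
pose U2 x := - (a x * g (Num.max 0 (U x))) - h (U x) * U1 x.
have HUc x : 0 <= x <= T -> {for x, continuous (fun t => H (U t))}.
  move=> /Upos ux; apply: continuous_comp; first exact: Uc.
  by have [dHx _] := dH (ltW ux); apply/differentiable_continuous/derivable1_diffP.
have U1c x : 0 <= x <= T -> {for x, continuous U1}.
  by move=> xT; apply: cvgB; [exact: Yc|exact: HUc].
have gUc : continuous (fun x => g (Num.max 0 (U x))).
  by move=> x; exact: (continuous_comp (@Uc x) (@gc (U x))).
have hUc : continuous (fun x => h (U x)).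
  by move=> x; exact: (continuous_comp (@Uc x) (@hc (U x))).
have U2c x : 0 <= x <= T -> {for x, continuous U2}.
  move=> xT; apply: cvgB.
    by apply: cvgN; apply: cvgM; [exact: ac|exact: gUc].
  by apply: cvgM; [exact: hUc|exact: U1c].
have gU x : 0 <= x <= T -> g (Num.max 0 (U x)) = g (U x).
  by move=> /Upos ux; rewrite max_r // ltW.
have oo_cc t : 0 < t < T -> 0 <= t <= T by move=> /andP[? ?]; rewrite !ltW.
have dY' : primitive (fun t => - (a t * g (Num.max 0 (U t)))) Y 0 T.
  by apply: (primitive_eq dY) => // x /oo_cc xT; rewrite gU.
have dU1 : primitive U2 U1 0 T.
  apply: is_derive_primitive.
    apply: continuous_in_subspaceT => x; rewrite inE /= in_itv /=; exact: U1c.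
  move=> x xT; have xT' := oo_cc _ xT.
  have ? : is_derive x (1 : R) U (U1 x) := primitive_is_derive dU (U1c _ xT') xT.
  have ? : is_derive x (1 : R) Y (- (a x * g (Num.max 0 (U x)))).
    apply: (primitive_is_derive dY') => //.
    by apply: cvgN; apply: cvgM; [exact: ac|exact: gUc].
  have ? := dH (ltW (Upos xT')).
  have ? : is_derive x (1 : R) (H \o U) (h (U x) * U1 x) by apply: is_derive1_comp.
  exact: is_deriveB.
exists U1, U2; split.
- move=> x; rewrite in_itv /= => xT.
  exact: (primitive_is_derive_within dU (U1c _ xT) xT).
- move=> x; rewrite in_itv /= => xT.
  exact: (primitive_is_derive_within dU1 (U2c _ xT) xT).
- apply: continuous_in_subspaceT => x; rewrite inE /= in_itv /=; exact: U2c.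
- move=> x; rewrite in_itv /= => /oo_cc xT; rewrite /U2 gU //; ring.
- by rewrite /U1 U0T Y0T.
Qed.

End Classical.

Section Rotation.
Variables (R : realType) (T c : R) (a : R -> R).
Hypotheses (T0 : 0 < T) (cT : 0 < c < T) (ac : continuous a).

(** Translation by [c] modulo [T]: [0] and [T] both go to [c], and [T - c] goes to [0]. *)
Definition original_time (x : R) := if x < T - c then x + c else x - (T - c).

Definition rotate x := a (original_time x).

Let cT' : c < T. Proof. by case/andP: cT. Qed.
Let c0 : 0 < c. Proof. by case/andP: cT. Qed.

Lemma rotate_left x : x < T - c -> rotate x = a (x + c).
Proof. by rewrite /rotate /original_time => ->. Qed.

Lemma rotate_right x : T - c <= x -> rotate x = a (x - (T - c)).
Proof. by rewrite /rotate /original_time leNgt => /negbTE ->. Qed.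

(** The exception is the junction of [a T] with [a 0], which may differ. *)
Lemma rotate_continuous x : x != T - c -> {for x, continuous rotate}.
Proof.
move=> xD; apply: dist_continuous => e e0.
have a1c : continuous (fun t => a (t + c)).
  move=> t; apply: continuous_comp; last exact: ac.
  by apply: cvgD; [|exact: cvg_cst].
have a2c : continuous (fun t => a (t - (T - c))).
  move=> t; apply: continuous_comp; last exact: ac.
  by apply: cvgB; [|exact: cvg_cst].
move: xD; rewrite neq_lt => /orP[xD|Dx].
  have [d d0 hd] := continuous_dist (@a1c x) e0.
  exists (Num.min d (T - c - x)); first by rewrite lt_min d0 subr_gt0.
  move=> y; rewrite lt_min => /andP[yd yx]; rewrite !rotate_left ?hd //.
  by have := le_lt_trans (ler_norm _) yx; rewrite ltrD2r.
have [d d0 hd] := continuous_dist (@a2c x) e0.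
exists (Num.min d (x - (T - c))); first by rewrite lt_min d0 subr_gt0.
move=> y; rewrite lt_min => /andP[yd yx].
rewrite !rotate_right ?hd ?(ltW Dx) //.
rewrite distrC in yx; have := le_lt_trans (ler_norm _) yx.
by rewrite ltrD2l ltrN2 => /ltW.
Qed.

Lemma rotate_primitive : exists S : R -> R,
  [/\ continuous S, primitive rotate S 0 T &
      S T - S 0 = \int[lebesgue_measure]_(x in `[0, T]) a x].
Proof.
have [F dF] := continuous_antiderivative (-1) ac.
have {}dF (x : R) : 0 <= x -> is_derive x (1 : R) F (a x).
  by move=> x0; apply: dF; apply: lt_le_trans x0; rewrite oppr_lt0.
have Fc (x : R) : 0 <= x -> {for x, continuous F}.
  by move=> /dF [dFx _]; apply/differentiable_continuous/derivable1_diffP.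
have pF : primitive a F 0 T.
  apply: is_derive_primitive => [|x /andP[x0 _]]; last by apply: dF; exact: ltW.
  apply: continuous_in_subspaceT => x; rewrite inE /= in_itv /= => /andP[x0 _].
  exact: Fc.
(* On [[0, T - c]] the second term is [F 0], on [[T - c, T]] the first is [F T]; both pieces equal
   [F T] at [T - c]. *)
pose S x := F (clamp T (x + c)) + F (clamp T (x - (T - c))) - F 0.
have clc := clamp_continuous (ltW T0).
have FClc : continuous (fun x => F (clamp T x)).
  move=> x; apply: continuous_comp; first exact: clc.
  by apply: Fc; case/andP: (clamp_itv x (ltW T0)).
have Sleft x : 0 <= x <= T - c -> S x = F (x + c).
  move=> /andP[x0 xD]; rewrite /S (clamp_le0 _ (_ : x - (T - c) <= 0)) ?subr_le0 //.
  by rewrite addrK clamp_id // addr_ge0 ?(ltW c0) //= -lerBrDr.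
have Sright x : T - c <= x <= T -> S x = F (x - (T - c)) + (F T - F 0).
  move=> /andP[Dx xT]; rewrite /S.
  have -> : clamp T (x + c) = T.
    by rewrite /clamp min_r ?max_r ?(ltW T0) // -lerBlDr.
  rewrite clamp_id; first by ring.
  by rewrite subr_ge0 Dx lerBlDr (le_trans xT) // lerDl subr_ge0 ltW.
have D0 : 0 < T - c by rewrite subr_gt0.
have DT : T - c < T by rewrite gtrDl oppr_lt0.
exists S; split.
- move=> x; apply: cvgB; last exact: cvg_cst.
  have shift k : {for x, continuous (fun t : R => t + k)}.
    by apply: cvgD; [|exact: cvg_cst].
  apply: cvgD; first exact: (continuous_comp (shift c) (@FClc (x + c))).
  exact: (continuous_comp (shift (- (T - c))) (@FClc (x - (T - c)))).
- apply: (primitive_cat (ltW D0) (ltW DT)).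
    apply: (@primitive_eq _ (fun x => a (x + c)) (fun x => F (x + c))) => //.
    + apply: primitive_shift; apply: (primitive_sub pF); first by rewrite add0r ltW.
      by rewrite subrK.
    + by move=> x /andP[_ xD]; exact: rotate_left.
  apply: (@primitive_eq _ (fun x => a (x - (T - c)))
    (fun x => F (x - (T - c)) + (F T - F 0))) => //.
  + have sh : primitive (fun x => a (x - (T - c))) (fun x => F (x - (T - c))) (T - c) T.
      apply: primitive_shift; apply: (primitive_sub pF); first by rewrite subrr.
      by rewrite gerDl oppr_le0 ltW.
    move=> s t k h1 h2 h3 /=; rewrite (_ : _ - (_ + _) = F (t - (T - c)) - F (s - (T - c))).
      exact: sh.
    by ring.
  + by move=> x /andP[Dx _]; rewrite rotate_right // ltW.
- have T1 : T - c <= T <= T by rewrite lexx ltW.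
  have T2 : (0 : R) <= 0 <= T - c by rewrite lexx ltW.
  rewrite Sright // Sleft // add0r (_ : T - (T - c) = c); last by ring.
  rewrite addrAC subrr add0r.
  rewrite /Rintegral (@continuous_FTC2 R a F 0 T T0) //.
  + exact: continuous_subspaceT.
  + split; first by move=> x; rewrite in_itv /= => /andP[/ltW /dF [] //].
      by apply: cvg_at_right_filter; exact: Fc.
    by apply: cvg_at_left_filter; apply: Fc; exact: ltW.
  + move=> x; rewrite in_itv /= => /andP[/ltW /dF dFx _].
    by rewrite derive1E; exact: derive_val.
Qed.

End Rotation.

Section NoMaximum.
Variables (R : realType) (T L c : R) (h H g a : R -> R).
Hypotheses (T0 : 0 < T) (L0 : 0 <= L) (cT : 0 < c < T) (ac : continuous a).
Hypotheses (hc : continuous h) (hL : forall s : R, `|h s| <= L).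
Hypothesis dH : forall s : R, 0 <= s -> is_derive s (1 : R) H (h s).
Hypothesis g_ge0 : forall s : R, 0 <= s -> 0 <= g s.
Hypothesis g_large : forall K : R,
  exists2 s0 : R, 0 < s0 & forall v : R, s0 <= v -> K * v <= g v.

(** The hypothesis [no_max] of [periodic_system] for an arbitrary set of maximum points, so that an
    interval cut by the base point can be treated in two pieces. *)
Definition no_max_in (P : R -> Prop) := exists M0 : R, 0 < M0 /\
  forall (M x1 : R) (gM u y : R -> R), M0 <= M ->
    continuous gM -> continuous u -> continuous y ->
    (forall v : R, 0 <= v <= M -> gM v = g v) ->
    primitive (fun v => y v - H (u v)) u 0 T ->
    primitive (fun v => - (rotate T c a v * gM (u v))) y 0 T ->
    (forall v : R, 0 <= v <= T -> 0 < u v <= M) ->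
    0 <= x1 <= T -> P x1 -> u x1 = M -> False.

Lemma no_max_inU (P Q W : R -> Prop) : no_max_in P -> no_max_in Q ->
  (forall x, 0 <= x <= T -> W x -> P x \/ Q x) -> no_max_in W.
Proof.
move=> [M1 [M10 h1]] [M2 [M20 h2]] PQW; exists (M1 + M2); split; first exact: addr_gt0.
move=> M x1 gM u y MM gMc uc yc gMg du dy uM x1T Wx1 ux1.
have [Px1|Qx1] := PQW _ x1T Wx1.
  apply: (h1 M x1 gM u y) => //; apply: le_trans MM; by rewrite lerDl ltW.
apply: (h2 M x1 gM u y) => //; apply: le_trans MM; by rewrite lerDr ltW.
Qed.

Let cT' : c < T. Proof. by case/andP: cT. Qed.

Lemma no_max_left (a0 l s t r : R) : 0 < a0 -> c <= l -> l < s -> s < t -> t < r -> r <= T ->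
  (forall x, l < x < r -> 0 <= a x) -> (forall x, s <= x <= t -> a0 <= a x) ->
  no_max_in (fun x => l <= x + c <= r).
Proof.
move=> a00 cl ls st tr rT a_ge0 a_ge.
have [M0 M00 hM0] := @no_large_max R T L h H T0 L0 hc hL dH a0 (l - c) (s - c)
  (t - c) (r - c) g a00 ltac:(by rewrite subr_ge0) ltac:(by rewrite ltrD2r)
  ltac:(by rewrite ltrD2r) ltac:(by rewrite ltrD2r)
  ltac:(by rewrite lerBlDr (le_trans rT) // lerDl ltW //; case/andP: cT) g_ge0 g_large.
exists M0; split=> // M x1 gM u y MM gMc uc yc gMg du dy uM x1T x1lr ux1.
apply: (hM0 M x1 (rotate T c a) (fun x => a (x + c)) gM u y) => //.
- move=> x; apply: continuous_comp; last exact: ac.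
  by apply: cvgD; [|exact: cvg_cst].
- move=> x /andP[lx xr]; rewrite rotate_left.
    by split=> //; apply: a_ge0; rewrite -ltrBlDr lx -ltrBrDr.
  by apply: lt_le_trans xr _; rewrite lerD2r.
- by move=> x /andP[sx xt]; apply: a_ge; rewrite -lerBlDr ltW //= -lerBrDr ltW.
- by rewrite lerBlDr lerBrDr.
Qed.

Lemma no_max_right (a0 l s t r : R) : 0 < a0 -> 0 <= l -> l < s -> s < t -> t < r -> r <= c ->
  (forall x, l < x < r -> 0 <= a x) -> (forall x, s <= x <= t -> a0 <= a x) ->
  no_max_in (fun x => l <= x - (T - c) <= r).
Proof.
move=> a00 l0 ls st tr rc a_ge0 a_ge.
have D0 : 0 < T - c by rewrite subr_gt0.
have [M0 M00 hM0] := @no_large_max R T L h H T0 L0 hc hL dH a0 (l + (T - c)) (s + (T - c))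
  (t + (T - c)) (r + (T - c)) g a00 ltac:(by rewrite addr_ge0 // ltW) ltac:(by rewrite ltrD2r)
  ltac:(by rewrite ltrD2r) ltac:(by rewrite ltrD2r)
  ltac:(by rewrite addrCA gerDl subr_le0) g_ge0 g_large.
exists M0; split=> // M x1 gM u y MM gMc uc yc gMg du dy uM x1T x1lr ux1.
apply: (hM0 M x1 (rotate T c a) (fun x => a (x - (T - c))) gM u y) => //.
- move=> x; apply: continuous_comp; last exact: ac.
  by apply: cvgB; [|exact: cvg_cst].
- move=> x /andP[lx xr]; rewrite rotate_right.
    by split=> //; apply: a_ge0; rewrite ltrBrDr lx ltrBlDr.
  by apply: le_trans (ltW lx); rewrite lerDr.
- by move=> x /andP[sx xt]; apply: a_ge; rewrite lerBrDr ltW //= lerBlDr ltW.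
- by move: x1lr; rewrite lerBrDr lerBlDr.
Qed.

(** Rotation keeps an interval that misses [c] in one piece. If [s < c < t] it leaves one piece at
    each end of the period, and each still contains a part of [[s, t]], where [a >= a0]. *)
Lemma no_max_itv (a0 l s t r : R) : 0 < a0 -> 0 <= l -> l < s -> s < t -> t < r -> r <= T ->
  [\/ r < c, c < l | s < c < t] ->
  (forall x, l < x < r -> 0 <= a x) -> (forall x, s <= x <= t -> a0 <= a x) ->
  no_max_in (fun x => l <= original_time T c x <= r).
Proof.
move=> a00 l0 ls st tr rT cI a_ge0 a_ge; case: cI => [rc|cl|/andP[sc ct]].
- have nm := no_max_right a00 l0 ls st tr (ltW rc) a_ge0 a_ge.
  (* Equal arguments only serve to change the set of maximum points; the other part of the period
     cannot meet the interval. *)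
  apply: (no_max_inU nm nm) => x /andP[x0 _].
  rewrite /original_time; case: (ltP x (T - c)) => xD lxr; last by left.
  by case/andP: lxr => _ /le_lt_trans /(_ rc); rewrite gtrDr ltNge x0.
- have nm := no_max_left a00 (ltW cl) ls st tr rT a_ge0 a_ge.
  apply: (no_max_inU nm nm) => x /andP[_ xT].
  rewrite /original_time; case: (ltP x (T - c)) => xD lxr; first by left.
  by case/andP: lxr => /(lt_le_trans cl); rewrite ltNge lerBlDr addrC subrK xT.
have lc : l < c by exact: lt_trans sc.
have cr : c < r by exact: lt_trans tr.
(* The middle thirds of [[c, t]] and of [[s, c]] lie strictly inside the two pieces. *)
pose d := (t - c) / 3; pose e := (c - s) / 3.
have d0 : 0 < d by rewrite divr_gt0 // subr_gt0.
have e0 : 0 < e by rewrite divr_gt0 // subr_gt0.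
have td : t = c + d *+ 3 by rewrite /d -mulr_natr divfK // addrC subrK.
have se : s = c - e *+ 3 by rewrite /e -mulr_natr divfK // subKr.
have leD (x n : nat) : (x <= n)%N -> c + d *+ x <= c + d *+ n.
  by move=> xn; rewrite lerD2l ler_pMn2l.
have ltD (x n : nat) : (x < n)%N -> c + d *+ x < c + d *+ n.
  by move=> xn; rewrite ltrD2l ltr_pMn2l.
have leE (x n : nat) : (x <= n)%N -> c - e *+ n <= c - e *+ x.
  by move=> xn; rewrite lerD2l lerN2 ler_pMn2l.
have ltE (x n : nat) : (x < n)%N -> c - e *+ n < c - e *+ x.
  by move=> xn; rewrite ltrD2l ltrN2 ltr_pMn2l.
have nmr : no_max_in (fun x => c <= x + c <= r).
  apply: (@no_max_left a0 c (c + d *+ 1) (c + d *+ 2) r) => //.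
  - by have := ltD 0%N 1%N isT; rewrite addr0.
  - exact: ltD.
  - by apply: lt_trans tr; rewrite td; exact: ltD.
  - by move=> x /andP[cx xr]; apply: a_ge0; rewrite xr (lt_trans lc).
  move=> x /andP[cx xt]; apply: a_ge; apply/andP; split.
    by rewrite ltW // (lt_trans sc) // (lt_le_trans _ cx) // ltrDl mulr1n.
  by apply: le_trans xt _; rewrite td; exact: leD.
have nml : no_max_in (fun x => l <= x - (T - c) <= c).
  apply: (@no_max_right a0 l (c - e *+ 2) (c - e *+ 1) c) => //.
  - by apply: lt_trans ls _; rewrite se; exact: ltE.
  - exact: ltE.
  - by have := ltE 0%N 1%N isT; rewrite subr0.
  - by move=> x /andP[lx xc]; apply: a_ge0; rewrite lx (lt_trans xc).
  move=> x /andP[sx xc]; apply: a_ge; apply/andP; split.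
    by apply: le_trans sx; rewrite se; exact: leE.
  by rewrite ltW // (le_lt_trans xc) // (le_lt_trans _ ct) // gerDl oppr_le0 ltW.
apply: (no_max_inU nmr nml) => x /andP[x0 xT].
rewrite /original_time; case: (ltP x (T - c)) => xD /andP[h1 h2].
  by left; rewrite h2 lerDr x0.
by right; rewrite h1 lerBlDr addrC subrK.
Qed.

End NoMaximum.

Theorem theorem4p5 (R : realType) (T : R) (hT : 0 < T)
  (h : R -> R)
  (h_cont : {within `[0, +oo[, continuous h})
  (h_bnd : [bounded h s | s in `[0, +oo[])
  (g : R -> R)
  (g_ge0 : forall s, 0 <= s -> 0 <= g s)
  (g_cont : {within `[0, +oo[, continuous g})
  (g_ro : regularly_oscillating_at_zero g)
  (g0 : g 0 = 0)
  (g_gt0 : forall s, 0 < s -> 0 < g s)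
  (g_lim0 : g s / s @[s --> 0^'+] --> (0 : R))
  (g_limoo : g s / s @[s --> +oo] --> +oo)
  (a : R -> R)
  (a_cont : {within `[0, T], continuous a})
  (a_sign : exists (m : nat) (l r : 'I_m -> R),
    [/\ (1 <= m)%N,
        forall i, 0 <= l i /\ l i <= r i /\ r i <= T,
        forall i j, i != j -> `[l i, r i] `&` `[l j, r j] = set0 :> set R,
        forall i,
          {ae @lebesgue_measure R, forall x, x \in `[l i, r i] -> 0 <= a x} /\
          ~ {ae @lebesgue_measure R, forall x, x \in `[l i, r i] -> a x = 0}
      & {ae @lebesgue_measure R, forall x, x \in `[0, T] ->
          (forall i, x \notin `[l i, r i]) -> a x <= 0}])
  (a_int : \int[@lebesgue_measure R]_(x in `[0, T]) a x < 0) :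
  exists u : R -> R,
    periodic_solution T h a g u /\ (forall x, x \in `[0, T] -> 0 < u x).
Proof.
have [m [l [r [m1 lr disj Isign Iout]]]] := a_sign.
have [L L0 hL] : exists2 L : R, 0 <= L & forall s : R, 0 <= s -> `|h s| <= L.
  have [M [_ hM]] := h_bnd; exists (`|M| + 1) => [|s s0]; first by rewrite addr_ge0.
  apply: (hM (`|M| + 1)); last by rewrite /= in_itv /= andbT.
  by apply: le_lt_trans (ler_norm M) _; rewrite ltrDl.
(* Projections onto the half line and onto [[0, T]] make the data continuous on the whole line
   without changing them where they are constrained. *)
pose h0 s := h (Num.max 0 s); pose aa x := a (clamp T x).
have max0_itv (s : R) : `[0, +oo[%classic (Num.max 0 s).
  by rewrite /= in_itv /= andbT le_max lexx.
have h0c : continuous h0.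
  by apply: within_continuous_comp h_cont _ max0_itv; exact: max0_continuous.
have gmc : continuous (fun s : R => g (Num.max 0 s)).
  by apply: within_continuous_comp g_cont _ max0_itv; exact: max0_continuous.
have gcc (b : R) : 0 <= b -> continuous (fun s => g (clamp b s)).
  move=> b0; apply: within_continuous_comp g_cont _ _; first exact: clamp_continuous.
  by move=> s; rewrite /= in_itv /= andbT; case/andP: (clamp_itv s b0).
have aac : continuous aa.
  apply: within_continuous_comp a_cont _ _; first exact: clamp_continuous (ltW hT).
  by move=> s; rewrite /= in_itv /= clamp_itv // ltW.
have aaE x : 0 <= x <= T -> aa x = a x by move=> xT; rewrite /aa clamp_id.
have h0L s : `|h0 s| <= L by apply: hL; rewrite le_max lexx.
have [H1 dH1] := continuous_antiderivative (-1) h0c.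
pose H s := H1 s - H1 0.
have dH (s : R) : 0 <= s -> is_derive s (1 : R) H (h0 s).
  move=> s0; have ? : is_derive s (1 : R) H1 (h0 s).
    by apply: dH1; apply: lt_le_trans s0; rewrite oppr_lt0.
  by apply: is_derive_eq; rewrite subr0.
have H0 : H 0 = 0 by rewrite /H subrr.
have [A A0 aA] : exists2 A : R, 0 <= A & forall x, `|aa x| <= A.
  have nc : continuous (fun x => `|aa x|).
    by move=> x; apply: cvg_norm; exact: aac.
  have [z _ zmax] := EVT_max (ltW hT) (continuous_subspaceT nc).
  exists `|aa z| => // x; have -> : aa x = aa (clamp T x).
    by rewrite /aa (clamp_id (clamp_itv x (ltW hT))).
  by apply: zmax; rewrite in_itv /= clamp_itv // ltW.
have inI i x : l i <= x <= r i -> 0 <= x <= T.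
  have [l0 [_ rT]] := lr i.
  by move=> /andP[lx xr]; rewrite (le_trans l0) // (le_trans xr).
have aa_ge0 i x : l i < x < r i -> 0 <= aa x.
  move=> xlr; rewrite -oppr_le0.
  have nc : continuous (fun x => - aa x) by move=> t; apply: cvgN; exact: aac.
  apply: (@ae_le0_itv _ _ nc (fun x => x \in `[l i, r i]) (l i) (r i)) xlr.
    have [pos _] := Isign i; apply: negligibleS pos => z /= nz h1; apply: nz => zI.
    by rewrite oppr_le0 aaE; [exact: h1|move: zI; rewrite in_itv; exact: inI].
  by move=> z /andP[? ?]; rewrite in_itv /= !ltW.
have sub i : exists s t a0 : R,
    [/\ l i < s, s < t, t < r i, 0 < a0 & forall x, s <= x <= t -> a0 <= aa x].
  apply: (positive_subinterval aac); first exact: aa_ge0.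
  have [_ nz] := Isign i; apply: contra_not nz => /negligibleS; apply => z /= nz h1.
  apply: nz => zI; rewrite -aaE; first exact: h1.
  by move: zI; rewrite in_itv; exact: inI.
pose i0 : 'I_m := Ordinal m1.
have [s0 [t0 [a0 [ls st tr a00 a0le]]]] := sub i0.
have [l00 [_ r0T]] := lr i0.
(* The base point is interior to [[s0, t0]], as the third case of [no_max_itv] requires. *)
pose c := (s0 + t0) / 2.
have sc : s0 < c by rewrite /c; lra.
have ct : c < t0 by rewrite /c; lra.
have cT : 0 < c < T.
  by rewrite (le_lt_trans l00 (lt_trans ls sc)) (lt_le_trans (lt_trans ct tr)).
have [c0 cT'] : 0 < c /\ c < T by case/andP: cT.
have D0 : 0 < T - c by rewrite subr_gt0.
have DT : T - c < T by rewrite gtrDl oppr_lt0.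
pose Z i x := l i <= original_time T c x <= r i.
have g_large := large_quotient g_limoo.
have no_max i : no_max_in T c H g aa (Z i).
  have [li0 [_ riT]] := lr i.
  have no_max_i := @no_max_itv R T L c h0 H g aa hT L0 cT aac h0c h0L dH g_ge0 g_large.
  have [->|ni] := eqVneq i i0.
    apply: (no_max_i a0 _ s0 t0) => //; last exact: aa_ge0.
    by apply: Or33; rewrite sc.
  have [s [t [b [h1 h2 h3 h4 h5]]]] := sub i.
  apply: (no_max_i b _ s t) => //; last exact: aa_ge0.
  have [cl|lc] := ltP c (l i); first exact: Or32.
  have [rc|cr] := ltP (r i) c; first exact: Or31.
  (* By disjointness [c] belongs to no interval other than the one of index [i0]. *)
  exfalso; have : (`[l i, r i] `&` `[l i0, r i0])%classic c.
    split => /=; rewrite in_itv /= ?lc ?cr //.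
    by rewrite !ltW // ?(lt_trans ls) // (lt_trans ct).
  by rewrite disj.
have Zc x : original_time T c x = c -> Z i0 x.
  by move=> e; rewrite /Z e !ltW // ?(lt_trans ls) // (lt_trans ct).
have outside x : 0 <= x <= T -> (forall i, ~ Z i x) -> 0 < x < T /\
    exists2 z : R, x < z <= T & forall v : R, x < v < z -> rotate T c aa v <= 0.
  move=> /andP[x0 xT] nZ.
  (* Both ends of the rotated period correspond to [c], hence belong to [Z i0]. *)
  have xpos : 0 < x.
    rewrite lt_neqAle x0 andbT; apply/eqP => e; apply: (nZ i0); apply: Zc.
    by rewrite /original_time -e D0 add0r.
  have xltT : x < T.
    rewrite lt_neqAle xT andbT; apply/eqP => e; apply: (nZ i0); apply: Zc.
    by rewrite /original_time e ltNge (ltW DT) /=; ring.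
  split; first by rewrite xpos.
  have Iout' : {ae @lebesgue_measure R, forall x, x \in `[0, T] ->
      (forall i, x \notin `[l i, r i]) -> aa x <= 0}.
    apply: negligibleS Iout => z /= nz h1; apply: nz => zT zI; rewrite aaE; last first.
      by move: zT; rewrite in_itv.
    exact: h1.
  have posT : 0 <= original_time T c x < T.
    rewrite /original_time; case: (ltP x (T - c)) => xD; last by rewrite subr_ge0 xD ltrBlDr ltr_pwDr.
    by rewrite addr_ge0 ?(ltW c0) //= -ltrBrDr.
  have posI i : original_time T c x \notin `[l i, r i] by rewrite in_itv /=; apply/negP/nZ.
  have [z /andP[pz zT] hz] := outside_right aac Iout' posT posI.
  move: pz hz; rewrite /original_time; case: (ltP x (T - c)) => xD pz hz.
    exists (z - c).
      by rewrite ltrBrDr pz lerBlDr (le_trans zT) // lerDl ltW.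
    move=> v /andP[xv vz]; rewrite rotate_left.
      by apply: hz; rewrite ltrD2r xv -ltrBrDr.
    by apply: lt_le_trans vz _; rewrite lerD2r.
  (* The right neighbourhood is cut at the end of the rotated period, beyond which the shift no
     longer applies. *)
  exists (Num.min T (z + (T - c))).
    by rewrite lt_min xltT -ltrBlDr pz ge_min lexx.
  move=> v /andP[xv]; rewrite lt_min => /andP[vT vz]; rewrite rotate_right.
    by apply: hz; rewrite ltrD2r xv ltrBlDr.
  exact: le_trans xD (ltW xv).
have [S [Sc dS ST]] := rotate_primitive hT cT aac.
have STneg : S T - S 0 < 0.
  rewrite ST; move: a_int; congr (_ < _); apply: eq_Rintegral => x.
  by rewrite inE /= in_itv /= => /aaE.
have rotA t : `|rotate T c aa t| <= A by exact: aA.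
have DT' : 0 < T - c < T by rewrite D0.
have rotc (x : R) : 0 < x < T -> x != T - c -> {for x, continuous (rotate T c aa)}.
  by move=> _; exact: rotate_continuous.
have [u [y [[uc yc] upos du dy [uT yT]]]] := @periodic_system R T L A (T - c) h0 H g
  (rotate T c aa) S m Z hT L0 A0 DT' h0L dH H0 g_ge0 g0 gcc
  (small_quotient g_lim0) (regular_oscillation g_gt0 g_ro) rotA rotc Sc dS STneg no_max outside.
have [dU dY] := @unrotate_system R T c aa (rotate T c aa) u y H g hT cT
  (fun t h1 => rotate_left aa (proj2 (andP h1)))
  (fun t h1 => rotate_right aa (ltW (proj1 (andP h1)))) du dy uT yT.
have Upos x : 0 <= x <= T -> 0 < unrotate T c u x.
  by move=> xT; have [t tT ->] := unrotate_itv hT cT uT xT; exact: upos.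
exists (unrotate T c u); split; last by move=> x; rewrite in_itv; exact: Upos.
have [u1 [u2 [d1 d2 c2 eq per]]] := primitive_periodic_solution aac h0c gmc dH
  (unrotate_continuous hT uc) (unrotate_continuous hT yc) Upos dU dY
  (unrotate_period hT cT uT) (unrotate_period hT cT yT).
(* On [[0, T]] and at positive values the projected data coincide with the given ones. *)
exists u1, u2; split=> // x xT; rewrite -(eq x xT).
have {}xT : 0 <= x <= T by move: xT; rewrite in_itv /= => /andP[? ?]; rewrite !ltW.
by rewrite aaE // /h0 max_r // ltW // Upos.
Qed.
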